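(* Let $\lambda$ be a shape. A set $T\subseteq\mathrm{Seg}(\lambda)$ of segments is wide if and only if there exists an element $x\in\mathrm{GT}(\lambda)$ such that $$\{\hat f(s):\ s\in T\}=\Big\{\mathrm{con}(w,z):\ \bigwedge_{i=1}^l y_i\le w\lessdot z\le x\Big\},$$ where $y_1,\ldots,y_l$ are the elements covered by $x$ in $\mathrm{GT}(\lambda)$. Consequently, the poset $\Psi^w(\lambda)$ of wide sets of segments, ordered by inclusion, and the lattice-theoretic shard intersection order $\Psi^l(\lambda)$ of $\mathrm{GT}(\lambda)$ are isomorphic.
   Context: A shape is a finite vertex-induced subgraph $\lambda$ of the square grid $\mathbb{Z}^2$ (two points are adjacent iff they differ by 1 in exactly one coordinate and agree in the other). $(a,b)$ is immediately South of $(a,b+1)$ and immediately East of $(a-1,b)$; North and West are the reverse relations. A vertex of $\lambda$ is interior if all four of its grid neighbors are in $\lambda$, and a boundary vertex otherwise. A (boundary) path is a sequence of vertices $(v_0,\ldots,v_l)$ of $\lambda$, $l>0$, with $v_0,v_l$ boundary vertices, $v_1,\dots,v_{l-1}$ interior vertices, and each $v_i$ immediately South or East of $v_{i-1}$. A segment is a sequence of interior vertices $(v_0,\ldots,v_l)$, $l\ge 0$, with each $v_i$ immediately South or East of $v_{i-1}$; $\mathrm{Seg}(\lambda)$ is the set of segments. The concatenation $s\circ t$ of segments is defined when the first vertex of $t$ is immediately South or East of the last vertex of $s$. If $t=(v_i,\dots,v_j)$ is a contiguous subsequence of a path or segment $p=(v_0,\dots,v_l)$, then $p$ starts with $t$ if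 $i=0$ and otherwise enters $t$ from the West (resp. North) if $v_{i-1}$ is immediately West (resp. North) of $v_i$; $p$ ends with $t$ if $j=l$ and otherwise leaves $t$ to the East (resp. South) if $v_{j+1}$ is immediately East (resp. South) of $v_j$. For a segment $s$: $A_s$ (SW-subsegments) is the set of subsegments $t\subseteq s$ such that $s$ starts with $t$ or enters $t$ from the North, and $s$ ends with $t$ or leaves $t$ to the East. $K_s$ (NE-subsegments) is the set of $t\subseteq s$ such that $s$ starts with $t$ or enters $t$ from the West, and $s$ ends with $t$ or leaves $t$ to the South. Segments $s,t$ are friendly along a common subsegment $u$ if $u\in A_s\cap K_t$ or $u\in K_s\cap A_t$. A set $T\subseteq\mathrm{Seg}(\lambda)$ is wide if: (i) for all segments $s,t,u$ with $s\circ t=u$, $|T\cap\{s,t,u\}|\ne2$; (ii) if $s,t\in T$ are friendly along $u$ then $u\in T$; (iii) if $s=s_1\circ s_2\circ s_3$ with $s,s_2\in T$ and $s_2\in A_s$ or $s_2\in K_s$, then $s_1,s_3\in T$. Two paths $p,q$ kiss along a common segment $s$ if (up to exchanging) $p$ enters $s$ from the West and leaves to the South, while $q$ enters $s$ from the North and leaves to the East. The reduced nonkissing complex $\widetilde\Delta^{NK}(\lambda)$ has as faces the sets of pairwise nonkissing paths that are neither horizontal (only East steps) nor vertical (only South steps). It is known to be pure and thin, and if $F,F'$ are facets with $F\setminus\{p\}=F'\setminus\{q\}$, $p\ne q$, then $p,q$ kiss along a unique segment $s$. Write $F\xrightarrow{s}F'$ (a flip) if here $p$ enters $s$ from the West and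 leaves to the South and $q$ enters $s$ from the North and leaves to the East. The Grid-Tamari order $\mathrm{GT}(\lambda)$ is the poset on facets of $\widetilde\Delta^{NK}(\lambda)$ with $F\le F'$ iff $F'$ is obtained from $F$ by a (possibly empty) sequence of flips; it is known to be a congruence-uniform lattice whose Hasse diagram is the graph of flips. A set of segments is biclosed if it and its complement in $\mathrm{Seg}(\lambda)$ are both closed under concatenation. For a biclosed set $X$ (each $A_s$ is biclosed), $\eta(X)\in\mathrm{GT}(\lambda)$ is the facet obtained from $\{p_e:\ e\text{ a vertical edge of }\lambda\}$ by removing the vertical paths, where $p_e=(v_0,\ldots,v_l)$ is the unique path with $e=(v_{j-1},v_j)$ for some $j$ such that: for $1\le i\le j-1$, $v_{i-1}$ is North of $v_i$ if $(v_i,\ldots,v_{j-1})\in X$ and West of $v_i$ otherwise; and for $j\le k<l$, $v_{k+1}$ is East of $v_k$ if $(v_j,\ldots,v_k)\in X$ and South of $v_k$ otherwise. The map $f(s)=\eta(A_s)$ is a bijection from $\mathrm{Seg}(\lambda)$ to the join-irreducibles of $\mathrm{GT}(\lambda)$. For $w\lessdot z$ (a cover) in a finite lattice $L$, $\mathrm{con}(w,z)$ is the smallest lattice congruence identifying $w$ and $z$; for a join-irreducible $j$, $j_*$ is the unique element it covers. $\hat f(s)=\mathrm{con}(f(s)_*,f(s))$. A finite lattice is congruence-uniform if $j\mapsto\mathrm{con}(j_*,j)$ is a bijection from join-irreducibles of $L$ to join-irreducibles of the congruence lattice, and dually for meet-irreducibles. The lattice-theoretic shard intersection order $\Psi^l(\lambda)$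 is the collection of sets $\psi(x)=\{\mathrm{con}(w,z):\bigwedge_i y_i\le w\lessdot z\le x\}$, $x\in\mathrm{GT}(\lambda)$ ($y_i$ the elements covered by $x$; $\psi(x)=\emptyset$ if there are none), ordered by inclusion. *)

(* Defs.v *)
From Stdlib Require Import Relations.
From mathcomp Require Import all_boot all_order all_algebra finmap.
From mathcomp Require Import all_classical.

Set Implicit Arguments.
Unset Strict Implicit.
Unset Printing Implicit Defensive.

Import GRing.Theory.

Local Open Scope ring_scope.
Local Open Scope classical_set_scope.
Local Open Scope card_scope.

Notation vertex := (int * int)%type.

Definition nbN (u : vertex) : vertex := (u.1, u.2 + 1).
Definition nbS (u : vertex) : vertex := (u.1, u.2 - 1).
Definition nbE (u : vertex) : vertex := (u.1 + 1, u.2).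
Definition nbW (u : vertex) : vertex := (u.1 - 1, u.2).

Definition step (u v : vertex) : bool := (v == nbS u) || (v == nbE u).

Section SubsequencePosition.

(* The sequences these predicates are applied to are chains for [step], whose
   vertices are distinct: a contiguous subsequence occurs only once, so that the
   entering and leaving predicates speak of the same occurrence.  In all of them
   [t] is nonempty and the default value of [head] and [last] is irrelevant. *)
Implicit Types p t : seq vertex.

Definition subsegment t p : Prop := t <> [::] /\ infix t p.

Definition enters_from (nb : vertex -> vertex) p t : Prop :=
  exists a v b, p = rcons a v ++ t ++ b /\ v = nb (head v t).

Definition leaves_to (nb : vertex -> vertex) p t : Prop :=
  exists a w b, p = a ++ t ++ w :: b /\ w = nb (last w t).

End SubsequencePosition.

Section Shape.

(* A shape, being a vertex-induced subgraph, is given by its vertex set. *)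
Variable lam : {fset vertex}.
Implicit Types (u v : vertex) (p q r s t : seq vertex) (X T : set (seq vertex)).
Implicit Types F G : set (seq vertex).

Definition interior v : bool :=
  [&& v \in lam, nbN v \in lam, nbS v \in lam, nbE v \in lam & nbW v \in lam].

Definition boundary v : bool := (v \in lam) && ~~ interior v.

Definition Seg : set (seq vertex) :=
  [set s | [/\ s <> [::], all interior s & sorted step s]].

Definition is_path p : Prop :=
  exists v0 q vl, [/\ p = v0 :: rcons q vl, boundary v0, boundary vl,
    all interior q & sorted step p].

Definition horizontal p : bool := sorted (fun u v => v == nbE u) p.
Definition vertical p : bool := sorted (fun u v => v == nbS u) p.

Definition composable s t : Prop :=
  exists s' x y t', [/\ s = rcons s' x, t = y :: t' & step x y].

Definition SWsub s : set (seq vertex) :=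
  [set t | [/\ subsegment t s,
               prefix t s \/ enters_from nbN s t
             & suffix t s \/ leaves_to nbE s t]].

Definition NEsub s : set (seq vertex) :=
  [set t | [/\ subsegment t s,
               prefix t s \/ enters_from nbW s t
             & suffix t s \/ leaves_to nbS s t]].

Definition friendly s t r : Prop :=
  (SWsub s `&` NEsub t) r \/ (NEsub s `&` SWsub t) r.

Definition wide : set (set (seq vertex)) :=
  [set T | [/\ T `<=` Seg,
    (forall s t, Seg s -> Seg t -> composable s t ->
       ~ (T `&` [set s; t; s ++ t] #= `I_2)),
    (forall s t r, T s -> T t -> friendly s t r -> T r)
  & (forall s1 s2 s3, Seg s1 -> Seg s2 -> Seg s3 ->
       composable s1 s2 -> composable s2 s3 ->
       T (s1 ++ s2 ++ s3) -> T s2 ->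
       SWsub (s1 ++ s2 ++ s3) s2 \/ NEsub (s1 ++ s2 ++ s3) s2 ->
       T s1 /\ T s3)]].

Definition WS_NE p q s : Prop :=
  [/\ enters_from nbW p s, leaves_to nbS p s,
      enters_from nbN q s & leaves_to nbE q s].

Definition kissing p q : Prop :=
  exists2 s, Seg s & WS_NE p q s \/ WS_NE q p s.

Definition face F : Prop :=
  (forall p, F p -> [/\ is_path p, ~~ horizontal p & ~~ vertical p]) /\
  (forall p q, F p -> F q -> ~ kissing p q).

Definition facet : set (set (seq vertex)) :=
  [set F | face F /\ forall G, face G -> F `<=` G -> G = F].

Definition flip F G : Prop :=
  [/\ facet F, facet G & exists p q s,
    [/\ F p, G q, p <> q, F `\ p = G `\ q & Seg s /\ WS_NE p q s]].

(* The Grid-Tamari order is [gt_le] restricted to [facet]. *)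
Definition gt_le : set (seq vertex) -> set (seq vertex) -> Prop :=
  clos_refl_trans _ flip.

(* The path p_e for the vertical edge e from u = v_(j-1) to nbS u = v_j.  The
   conditions make sense for an arbitrary X, and are used here only for the
   biclosed sets X = [SWsub s].  The sequence c runs over the
   (v_i, .., v_(j-1)) and d over the (v_j, .., v_k). *)
Definition edge_path X u p : Prop :=
  is_path p /\ exists a b,
  [/\ p = rcons a u ++ nbS u :: b,
      (forall a' v c, rcons a u = rcons a' v ++ c -> c <> [::] ->
         v = if c \in X then nbN (head v c) else nbW (head v c))
    & (forall d w b', nbS u :: b = d ++ w :: b' -> d <> [::] ->
         w = if d \in X then nbE (last w d) else nbS (last w d))].

Definition eta X : set (seq vertex) :=
  [set p | ~~ vertical p /\
     exists u, [/\ u \in lam, nbS u \in lam & edge_path X u p]].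

End Shape.

(* Lattice theory for the order [le] on a carrier [L].  Meets and joins are
   relational, so that the notions below can be written down before [L] is known
   to be a lattice. *)
Section LatticeTheory.

Variables (T : Type) (L : set T) (le : T -> T -> Prop).

Definition is_glb (A : set T) (m : T) : Prop :=
  [/\ L m, forall y, A y -> le m y &
      forall l, L l -> (forall y, A y -> le l y) -> le l m].

Definition is_lub (A : set T) (m : T) : Prop :=
  [/\ L m, forall y, A y -> le y m &
      forall l, L l -> (forall y, A y -> le y l) -> le m l].

Definition covers (w z : T) : Prop :=
  [/\ L w, L z, le w z, w <> z &
      forall v, L v -> le w v -> le v z -> v = w \/ v = z].

Definition congruence (R : set (T * T)) : Prop :=
  [/\ R `<=` L `*` L,
      [/\ forall x, L x -> R (x, x),
          forall x y, R (x, y) -> R (y, x)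
        & forall x y z, R (x, y) -> R (y, z) -> R (x, z)],
      (forall x x' y y' m m', R (x, x') -> R (y, y') ->
         is_glb [set x; y] m -> is_glb [set x'; y'] m' -> R (m, m'))
    & (forall x x' y y' m m', R (x, x') -> R (y, y') ->
         is_lub [set x; y] m -> is_lub [set x'; y'] m' -> R (m, m'))].

Definition con (w z : T) : set (T * T) :=
  \bigcap_(R in [set R | congruence R /\ R (w, z)]) R.

(* When [x] covers nothing, the meet [m] is the top of [L] and [psi x] is
   empty. *)
Definition psi (x : T) : set (set (T * T)) :=
  [set R | exists m w z, [/\ is_glb [set y | covers y x] m,
     le m w, covers w z, le z x & R = con w z]].

End LatticeTheory.

Definition con_GT (lam : {fset vertex}) :=
  con (facet lam) (gt_le lam).

Definition psi_GT (lam : {fset vertex}) :=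
  psi (facet lam) (gt_le lam).

Definition join_irr (lam : {fset vertex}) (s : seq vertex) : set (seq vertex) :=
  eta lam (SWsub s).

(* [get] picks an element of a set; for a join-irreducible [j] the set is a
   singleton. *)
Definition lower_star (lam : {fset vertex}) (j : set (seq vertex)) :=
  get [set w | covers (facet lam) (gt_le lam) w j].

Definition fhat (lam : {fset vertex}) (s : seq vertex) :=
  con_GT lam (lower_star lam (join_irr lam s)) (join_irr lam s).

Definition shard_order (lam : {fset vertex}) :
    set (set (set (set (seq vertex) * set (seq vertex)))) :=
  psi_GT lam @` facet lam.

(* Isomorphism of two collections of sets, each ordered by inclusion. *)
Definition inclusion_isomorphic (T U : Type)
    (A : set (set T)) (B : set (set U)) : Prop :=
  exists phi : set T -> set U, set_bij A B phi /\
    forall X Y, A X -> A Y -> (X `<=` Y <-> phi X `<=` phi Y).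

(* Main.v *)
(* Think of segments as string modules, SW-subsegments as quotients and
   NE-subsegments as submodules.  Call a set of segments closed if it contains
   the SW-subsegments and the concatenations of its members; these "torsion
   classes" form a lattice under inclusion, which is isomorphic to the
   Grid-Tamari order through eta.  The inverse sends a facet F to the
   concatenations of the SW-subsegments of its paths: since the paths of F do not
   kiss, this set contains no NE-subsegment of a path of F, and a path is in
   eta(X) if and only if its SW-subsegments are in X and its NE-subsegments are
   not.  Along the vertical edges of such a path, membership in X of the segment
   between two edges defines a total order, and the path is p_e for the largest
   edge e.

   A cover of closed sets is labelled by the minimal segment s in the difference;
   it is perspective to the cover of A_s over A_s minus s, so its congruence is
   fhat(s).  The congruences obtained by forgetting the segments that contain a
   given one show that fhat is injective.  Hence, for x = eta(X), the set psi(x)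
   corresponds to the set of segments of X having no NE-subsegment in the meet of
   the lower covers of X.  This set consists of the concatenations of the labels
   of the lower covers of X, which form a "semibrick": no two distinct ones are
   friendly.  Every semibrick arises in this way, and the sets of concatenations
   of semibricks are exactly the wide sets. *)
From Stdlib Require Import Relations.
Require Import Defs.
From mathcomp Require Import all_boot all_order all_algebra finmap.
From mathcomp Require Import all_classical.
From mathcomp Require Import zify.

Set Implicit Arguments.
Unset Strict Implicit.
Unset Printing Implicit Defensive.

Import GRing.Theory.

Local Open Scope classical_set_scope.

(** Closed sets are biclosed: of two composed segments, one is always an SW-subsegment of the
    composite, namely the first if the joint goes East and the second if it goes South. So [eta]
    applies to them, and they select one canonical set for each facet; [SWsub s] is itself closed.
    The same remark about joints drives most arguments. Every concatenation has a piece that is an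
    SW-subsegment of it and a piece that is an NE-subsegment of it, whereas a subsegment of both
    kinds is the whole segment. A boolean colour for the joints lets one lemma serve both kinds. The
    obstacle on the side of the order is that a flip only says that two facets agree up to one path
    each. That the closed set grows along a flip needs its own argument, and conversely a cover of
    closed sets must be shown to exchange exactly one path. For this, the label of the cover is
    located on the paths: it singles out the vertical edges whose paths are exchanged. *)

Notation word := (seq vertex).
Notation v0 := ((0, 0)%R : vertex).

Implicit Types (a b m s t u w : seq vertex) (c : bool).

(** * Words, coloured joints and subsegments *)

Lemma cat_nil_eq a b : (a ++ b == [::]) = (a == [::]) && (b == [::]).
Proof. by case: a => [|x a] /=; rewrite ?eqxx. Qed.

Lemma cat_eq_cases a b a' b' : a ++ b = a' ++ b' ->
  (exists2 m, a' = a ++ m & b = m ++ b') \/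
  (exists m, [/\ m != [::], a = a' ++ m & b' = m ++ b]).
Proof.
elim: a a' => [|x a IH] [|y a'] /=.
- by move=> ->; left; exists [::].
- by move=> ->; left; exists (y :: a').
- by move=> <-; right; exists (x :: a).
- case=> <- /IH [[m -> ->]|[m [m0 -> ->]]]; first by left; exists m.
  by right; exists m.
Qed.

(** The first letter of [t] fixes its position. Occurrences that are quantified separately, as in
    entering and leaving, can thus be identified. *)
Lemma uniq_cat_inj s a t b a' b' : uniq s -> t != [::] ->
  s = a ++ t ++ b -> s = a' ++ t ++ b' -> a = a' /\ b = b'.
Proof.
case: t => // x t us _ E1 E2.
have ix d e : uniq (d ++ x :: e) -> index x (d ++ x :: e) = size d.
  rewrite cat_uniq /= negb_or => /and3P[_ /andP[xd _] _].
  by rewrite index_cat (negbTE xd) /= eqxx addn0.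
have sz : size a = size a'.
  by rewrite -(ix a (t ++ b)) -?E1 // E2 ix // -E2.
move/eqP: E2; rewrite E1 eqseq_cat // eqseq_cat // => /and3P[/eqP -> _ /eqP ->].
by [].
Qed.

(* The joint between two consecutive pieces: [c = true] for a South step,
   [c = false] for an East step; vacuous when a piece is empty. *)
Definition jt c a b : bool :=
  [|| a == [::], b == [::] | (head v0 b == nbS (last v0 a)) == c].

Lemma jt0l c b : jt c [::] b. Proof. by []. Qed.
Lemma jt0r c a : jt c a [::]. Proof. by rewrite /jt eqxx orbT. Qed.

Lemma jt_catl c a m t : m != [::] -> jt c (a ++ m) t = jt c m t.
Proof.
by case: m => // x m _; rewrite /jt cat_nil_eq andbF last_cat.
Qed.

Lemma jt_catr c t m b : m != [::] -> jt c t (m ++ b) = jt c t m.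
Proof. by case: m. Qed.

Lemma jt_neg c a b : a != [::] -> b != [::] -> jt (~~ c) a b = ~~ jt c a b.
Proof.
by rewrite /jt => /negbTE -> /negbTE -> /=; case: (_ == nbS _); case: c.
Qed.

Lemma jt_either c a b : jt c a b \/ jt (~~ c) a b.
Proof.
rewrite /jt; case: (a == _); case: (b == _) => /=; auto.
by case: (_ == nbS _); case: c; auto.
Qed.

Lemma jt_contra c a b : a != [::] -> b != [::] -> jt c a b -> jt (~~ c) a b -> False.
Proof. by move=> a0 b0 ab; rewrite jt_neg // ab. Qed.

(* [sub true] is [SWsub] and [sub false] is [NEsub]. *)
Definition sub c s t : Prop :=
  exists a b, [/\ s = a ++ t ++ b, t != [::], jt c a t & jt (~~ c) t b].

Lemma sub_refl c s : s != [::] -> sub c s s.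
Proof. by exists [::], [::]; rewrite cats0 jt0r. Qed.

Lemma sub_ne c s t : sub c s t -> t != [::].
Proof. by case=> a [b []]. Qed.

Lemma sub_size c s t : sub c s t -> size t <= size s.
Proof. by case=> a [b [-> _ _ _]]; rewrite !size_cat; lia. Qed.

Lemma sub_size_eq c s t : sub c s t -> size s <= size t -> t = s.
Proof.
case=> -[|x a] [[|y b] [-> _ _ _]]; rewrite /= ?cats0 // !size_cat /=; lia.
Qed.

(** A joint of [u] in [s] is a joint of [u] in [t], unless [u] reaches that end of [t]; then it is
    the joint of [t] in [s]. *)
Lemma sub_trans c s t u : sub c s t -> sub c t u -> sub c s u.
Proof.
case=> a [b [-> t0 h1 h2]] [a' [b' [E u0 h3 h4]]].
exists (a ++ a'), (b' ++ b); split=> //; first by rewrite E !catA.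
- have [E'|n0] := eqVneq a' [::]; last by rewrite jt_catl.
  by move: h1; rewrite E E' /= cats0 jt_catr.
- have [E'|n0] := eqVneq b' [::]; last by rewrite jt_catr.
  by move: h2; rewrite E E' /= cats0 jt_catl.
Qed.

Lemma sub_prefix c a b : a != [::] -> jt (~~ c) a b -> sub c (a ++ b) a.
Proof. by exists [::], b. Qed.

Lemma sub_suffix c a b : b != [::] -> jt c a b -> sub c (a ++ b) b.
Proof. by exists a, [::]; rewrite cats0 jt0r. Qed.

(** A nonempty flank would meet [t] in a joint of both colours. *)
Lemma sub_both c s t : uniq s -> sub c s t -> sub (~~ c) s t -> t = s.
Proof.
move=> us [a [b [E t0 h1 h2]]] [a' [b' [E' _ h3 h4]]].
have [? ?] := uniq_cat_inj us t0 E E'; subst a' b'.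
rewrite negbK in h4.
have a0 : a = [::].
  by apply/eqP/negPn/negP => a0; apply: (jt_contra a0 t0 h1 h3).
have b0 : b = [::].
  by apply/eqP/negPn/negP => b0; apply: (jt_contra t0 b0 h4 h2).
by rewrite E a0 b0 cats0.
Qed.

(** In the third case [t] straddles the cut. Then [t1] and [t2] are again [c]-subsegments of [a] and
    [b], while the joint between them may have either colour. *)
Lemma sub_cat c a b t : sub c (a ++ b) t ->
  [\/ sub c a t, sub c b t |
    exists t1 t2 a1 b2, [/\ [/\ t = t1 ++ t2, t1 != [::] & t2 != [::]],
      a = a1 ++ t1, b = t2 ++ b2, jt c a1 t1 & jt (~~ c) t2 b2]].
Proof.
case=> x [y [E t0 h1 h2]].
case: (cat_eq_cases E) => [[m Ex Eb]|[m [m0 Ea Et]]].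
- apply: Or32; exists m, y; split=> //.
  have [->|m0] := eqVneq m [::]; first exact: jt0l.
  by move: h1; rewrite Ex jt_catl.
- case: (cat_eq_cases Et) => [[n Em Ey]|[n [n0 Et' Eb]]].
  + apply: Or31; exists x, n; split=> //; first by rewrite Ea Em.
    have [->|n0] := eqVneq n [::]; first exact: jt0r.
    by move: h2; rewrite Ey jt_catr.
  + apply: Or33; exists m, n, x, y; split=> //.
    * by move: h1; rewrite Et' jt_catr.
    * by move: h2; rewrite Et' jt_catl.
Qed.

(** Every step, South or East, raises this number by one. Hence a chain for [step] has distinct
    vertices, and positions in it can be read off. *)
Definition rk (v : vertex) : int := (v.1 - v.2)%R.

Lemma step_rk (x y : vertex) : step x y -> rk y = (rk x + 1)%R.
Proof. by case/orP => /eqP ->; rewrite /rk /=; lia. Qed.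

Lemma sorted_step_uniq s : sorted step s -> uniq s.
Proof.
move=> ss; apply: (@sorted_uniq _ (fun x y : vertex => (rk x < rk y)%R)).
- by move=> ? ? ?; apply: Order.POrderTheory.lt_trans.
- by move=> ?; apply: Order.POrderTheory.ltxx.
- by apply: sub_sorted ss => x y /step_rk ->; lia.
Qed.

Lemma sorted_catl (T : Type) (e : rel T) (a b : seq T) :
  sorted e (a ++ b) -> sorted e a.
Proof. by case: a => //= x a; rewrite cat_path => /andP[]. Qed.

Lemma sorted_catr (T : Type) (e : rel T) (a b : seq T) :
  sorted e (a ++ b) -> sorted e b.
Proof.
by case: a => //= x a; rewrite cat_path => /andP[_]; case: b => //= y b /andP[].
Qed.

Lemma sorted_cat (e : rel vertex) a b :
  a != [::] -> b != [::] ->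
  sorted e (a ++ b) = [&& sorted e a, e (last v0 a) (head v0 b) & sorted e b].
Proof. by case: a b => [|x a] [|y b] //= _ _; rewrite cat_path. Qed.

(** * Closed sets of segments *)

Section Segments.

Variable lam : {fset vertex}.
Implicit Types (X Y Z S : set word).

Local Notation Seg := (Seg lam).

Lemma Seg_ne s : Seg s -> s != [::].
Proof. by case=> /eqP. Qed.

Lemma Seg_uniq s : Seg s -> uniq s.
Proof. by case=> _ _ /sorted_step_uniq. Qed.

Lemma Seg_catl a b : Seg (a ++ b) -> a != [::] -> Seg a.
Proof.
case=> _; rewrite all_cat => /andP[ia _] /sorted_catl sa /eqP a0; by split.
Qed.

Lemma Seg_catr a b : Seg (a ++ b) -> b != [::] -> Seg b.
Proof.
case=> _; rewrite all_cat => /andP[_ ib] /sorted_catr sb /eqP b0; by split.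
Qed.

Lemma Seg_cat a b : Seg a -> Seg b ->
  step (last v0 a) (head v0 b) -> Seg (a ++ b).
Proof.
move=> Sa Sb st; have a0 := Seg_ne Sa; have b0 := Seg_ne Sb.
case: Sa Sb => _ ia sa [_ ib sb]; split.
- by move/eqP; rewrite cat_nil_eq (negbTE a0).
- by rewrite all_cat ia.
- by rewrite sorted_cat // sa sb st.
Qed.

Lemma Seg_sub c s t : Seg s -> sub c s t -> Seg t.
Proof.
move=> Ss [a [b [E t0 _ _]]]; move: Ss; rewrite E => /Seg_catr-/(_ _)/Seg_catl.
by apply=> //; case: (t) t0.
Qed.

Inductive concats (S : set word) : word -> Prop :=
| cc1 s : S s -> concats S s
| cc_cons a b : S a -> concats S b -> Seg (a ++ b) -> concats S (a ++ b).

Definition concat_closed (X : set word) :=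
  forall a b, X a -> X b -> Seg (a ++ b) -> X (a ++ b).

Definition A_closed (X : set word) := forall s t, X s -> sub true s t -> X t.

Definition lat : set (set word) :=
  [set X | [/\ X `<=` Seg, A_closed X & concat_closed X]].

Lemma cc_Seg S : S `<=` Seg -> concats S `<=` Seg.
Proof. by move=> SS t; case=> [s /SS|]. Qed.

Lemma cc_app S : S `<=` Seg -> concat_closed (concats S).
Proof.
move=> SS a b ca; elim: ca b => {a} [a Sa|a a' Sa ca IH Sg] b cb Sab.
  exact: cc_cons.
rewrite -catA in Sab *; apply: cc_cons => //; apply: IH => //.
apply: (Seg_catr Sab); case: (a') (cc_Seg SS ca) => // -[]; by [].
Qed.

Lemma cc_snoc S : S `<=` Seg -> forall t, concats S t ->
  S t \/ exists a b, [/\ t = a ++ b, concats S a & S b].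
Proof.
move=> SS t; elim=> {t} [s|a b Sa cb IH Sg]; first by left.
right; case: IH => [Sb|[a' [b' [E ca' Sb']]]].
  by exists a, b; split=> //; apply: cc1.
exists (a ++ a'), b'; rewrite E catA; split=> //; apply: cc_cons => //.
rewrite E catA in Sg; apply: (Seg_catl Sg).
by rewrite cat_nil_eq (negbTE (Seg_ne (SS _ Sa))).
Qed.

Lemma cc_min S X : concat_closed X -> S `<=` X -> concats S `<=` X.
Proof. by move=> cX SX t; elim=> [s /SX|a b /SX Xa _ Xb Sg] //; apply: cX. Qed.

Lemma cc_mono S X : S `<=` X -> concats S `<=` concats X.
Proof.
by move=> SX t; elim=> [s /SX|a b /SX Xa _ Xb Sg]; [apply: cc1|apply: cc_cons].
Qed.

(* Whatever the colours of the joints, one of the pieces is a [c]-subsegment: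
   scanning from the left, take the piece before the first joint of colour
   [~~ c]. *)
Lemma cc_piece c S t : S `<=` Seg -> concats S t -> exists2 v, S v & sub c t v.
Proof.
move=> SS; elim=> {t} [s Ss|a b Sa cb [v Sv bv] Sg].
  by exists s => //; apply/sub_refl/Seg_ne/SS.
have a0 := Seg_ne (SS _ Sa).
have b0 := Seg_ne (cc_Seg SS cb).
case: (jt_either c a b) => j; last by exists a => //; apply: sub_prefix.
by exists v => //; apply: sub_trans bv; apply: sub_suffix.
Qed.

(** A straddling SW-subsegment is cut into SW-subsegments of the pieces, so closing under
    SW-subsegments and then under concatenation suffices. *)
Lemma cc_A_closed S : S `<=` Seg -> A_closed S -> A_closed (concats S).
Proof.
move=> SS AS s + cs; elim: cs => {s} [s Ss|a b Sa cb IH Sg] t st.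
  exact/cc1/(AS s).
case: (sub_cat st) => [at_|bt|[t1 [t2 [a1 [b2 [[Et t10 t20] Ea Eb j1 j2]]]]]].
- exact/cc1/(AS a).
- exact: IH.
- rewrite Et; apply: cc_cons; last by rewrite -Et; apply: Seg_sub st.
  + by apply: (AS a) => //; rewrite Ea; apply: sub_suffix.
  + by apply: IH; rewrite Eb; apply: sub_prefix.
Qed.

Lemma cc_lat S : S `<=` Seg -> A_closed S -> lat (concats S).
Proof.
by move=> SS AS; split; [apply: cc_Seg|apply: cc_A_closed|apply: cc_app].
Qed.

Lemma latS X : lat X -> X `<=` Seg. Proof. by case. Qed.
Lemma latA X s t : lat X -> X s -> sub true s t -> X t.
Proof. by case=> _ AX _; apply: AX. Qed.
Lemma latC X a b : lat X -> X a -> X b -> Seg (a ++ b) -> X (a ++ b).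
Proof. by case=> _ _; apply. Qed.

Lemma lat_setI X Y : lat X -> lat Y -> lat (X `&` Y).
Proof.
move=> lX lY; split.
- by move=> s [/(latS lX)].
- by move=> s t [Xs Ys] st; split; [apply: latA Xs st|apply: latA Ys st].
- by move=> a b [? ?] [? ?] ?; split; apply: latC.
Qed.

Lemma lat_join X Y : lat X -> lat Y -> lat (concats (X `|` Y)).
Proof.
move=> lX lY; apply: cc_lat.
- by move=> s [/(latS lX)|/(latS lY)].
- by move=> s t [Xs|Ys] st; [left; apply: latA Xs st|right; apply: latA Ys st].
Qed.

Lemma sub_A_closed s : A_closed (sub true s).
Proof. by move=> t u; apply: sub_trans. Qed.

(** Ranks occur only once in [s], so [b] starts in [s] where [a] ends; the outer joints of [a ++ b]
    are those of [a] and [b]. *)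
Lemma sub_concat c s a b : Seg s -> sub c s a -> sub c s b -> Seg (a ++ b) ->
  sub c s (a ++ b).
Proof.
move=> Ss sa sb Sab.
have a0 := sub_ne sa; have b0 := sub_ne sb.
have Sb := Seg_sub Ss sb; have Sa := Seg_sub Ss sa.
case: sa sb => x [y [E _ h1 h2]] [x' [y' [E' _ h3 h4]]].
have sepE : sorted step s by case: Ss.
(* ranks locate [b] right after [a] in [s] *)
have rkE d z e : sorted step (d ++ z :: e) ->
    rk z = (rk (head v0 (d ++ z :: e)) + (size d)%:Z)%R.
  elim: d => [|z' d IH] /=; first by rewrite addr0.
  move=> pd; have := IH (path_sorted pd).
  by move: pd; case: (d) => [|z'' d'] /= /andP[/step_rk ->] _ ->; lia.
have rklast d : d != [::] -> sorted step d ->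
    rk (last v0 d) = (rk (head v0 d) + (size d).-1%:Z)%R.
  case/lastP: d => // d z _ sd; rewrite last_rcons size_rcons -cats1 in sd *.
  by rewrite (rkE d z [::]).
have e1 : rk (head v0 a) = (rk (head v0 s) + (size x)%:Z)%R.
  by move: (a) a0 E => [|z a'] // _ E2; rewrite E2 [LHS](rkE x z (a' ++ y)) // -E2.
have e2 : rk (head v0 b) = (rk (head v0 s) + (size x')%:Z)%R.
  by move: (b) b0 E' => [|z b'] // _ E2; rewrite E2 [LHS](rkE x' z (b' ++ y')) // -E2.
have e3 : rk (head v0 b) = (rk (last v0 a) + 1)%R.
  by case: Sab => _ _; rewrite sorted_cat // => /and3P[_ /step_rk].
have e4 := rklast _ a0 (let: And3 _ _ h := Sa in h).
have szx : size (x ++ a) = size x'.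
  by rewrite size_cat; move: e1 e2 e3 e4; case: (a) a0 => //= *; lia.
have Ex : x' = x ++ a.
  by move/eqP: E'; rewrite E catA eqseq_cat // => /andP[/eqP].
exists x, y'; split.
- by rewrite E' Ex !catA.
- by rewrite cat_nil_eq (negbTE a0).
- by rewrite jt_catr.
- by rewrite jt_catl.
Qed.

Lemma lat_sub s : Seg s -> lat (sub true s).
Proof.
move=> Ss; split; first by move=> t; apply: Seg_sub.
- exact: sub_A_closed.
- by move=> a b; apply: sub_concat.
Qed.

(* a composite equal to [s] would have a joint of both colours *)
Lemma lat_sub_proper s : Seg s -> lat [set t | sub true s t /\ t <> s].
Proof.
move=> Ss; split; first by move=> t [] /(Seg_sub Ss).
- move=> t u [st ts] tu; split; first exact: sub_trans tu.
  move=> us; apply: ts; apply: sub_size_eq st _.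
  by rewrite -us; apply: sub_size tu.
- move=> a b [sa as_] [sb bs] Sab; split; first exact: sub_concat.
  move=> E; have a0 := sub_ne sa; have b0 := sub_ne sb.
  case: (jt_either true a b) => j.
  + apply: as_; apply: (sub_both (Seg_uniq Ss) sa).
    by rewrite -E; apply: sub_prefix.
  + apply: bs; apply: (sub_both (Seg_uniq Ss) sb).
    by rewrite -E; apply: sub_suffix.
Qed.

(* Both [a] and [b] are SW-subsegments in [s = a ++ u ++ b]. *)
Lemma concat_around X s u : lat X -> X u -> Seg s -> sub false s u ->
  (forall t, sub true s t -> t <> s -> X t) -> X s.
Proof.
move=> lX Xu Ss [a [b [E u0 h1 h2]]] AX.
have neqs t d : s = t ++ d -> d != [::] -> t <> s.
  move=> -> d0 /(congr1 size); rewrite size_cat.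
  by case: d d0 => //= x d _; lia.
have neqs' t d : s = d ++ t -> d != [::] -> t <> s.
  move=> -> d0 /(congr1 size); rewrite size_cat.
  by case: d d0 => //= x d _; lia.
have Sub : Seg (u ++ b).
  by apply: (@Seg_catr a); rewrite -?E // cat_nil_eq (negbTE u0).
have ub0 : u ++ b != [::] by rewrite cat_nil_eq (negbTE u0).
have Xub : X (u ++ b).
  have [->|b0] := eqVneq b [::]; first by rewrite cats0.
  apply: latC => //; apply: AX.
  - rewrite E catA; apply: sub_suffix => //.
    by rewrite jt_catl.
  - by apply: (neqs' _ (a ++ u)); rewrite -?catA // cat_nil_eq (negbTE u0) andbF.
have [a0|a0] := eqVneq a [::]; first by rewrite E a0.
rewrite E; apply: latC => //; last by rewrite -E.
apply: AX; last exact: neqs E ub0.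
by rewrite E; apply: sub_prefix => //; rewrite jt_catr.
Qed.

(* In terms of string modules, the segments without nonzero maps to [s]. *)
Definition perp s : set word :=
  [set t | Seg t /\ forall u, sub true t u -> ~ sub false s u].

Lemma lat_perp s : lat (perp s).
Proof.
split; first by move=> t [].
- move=> t u [St pt] tu; split; first exact: Seg_sub tu.
  by move=> w uw; apply: pt; apply: sub_trans uw.
- move=> a b [Sa pa] [Sb pb] Sab; split=> // u abu su.
  case: (sub_cat abu) => [au|bu|].
  + exact: pa au su.
  + exact: pb bu su.
  case=> t1 [t2 [a1 [b2 [[Et t10 t20] Ea Eb j1 j2]]]].
  case: (jt_either true t1 t2) => j.
  + apply: (pa t1); first by rewrite Ea; apply: sub_suffix.
    by apply: sub_trans su _; rewrite Et; apply: sub_prefix.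
  + apply: (pb t2); first by rewrite Eb; apply: sub_prefix.
    by apply: sub_trans su _; rewrite Et; apply: sub_suffix.
Qed.

(** * Covers of closed sets and their labels *)

Lemma cover_or_eq X Y Z : covers lat subset X Y -> lat Z -> X `<=` Z -> Z `<=` Y ->
  Z = X \/ Z = Y.
Proof. by case=> _ _ _ _ h lZ; apply: h. Qed.

Lemma cover_mid_top X Y Z t : covers lat subset X Y -> lat Z -> X `<=` Z -> Z `<=` Y ->
  Z t -> ~ X t -> Z = Y.
Proof.
by move=> cXY lZ XZ ZY Zt nXt; case: (cover_or_eq cXY lZ XZ ZY) => // E; case: nXt; rewrite -E.
Qed.

Lemma cover_mid_bot X Y Z t : covers lat subset X Y -> lat Z -> X `<=` Z -> Z `<=` Y ->
  Y t -> ~ Z t -> Z = X.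
Proof.
by move=> cXY lZ XZ ZY Yt nZt; case: (cover_or_eq cXY lZ XZ ZY) => // E; case: nZt; rewrite E.
Qed.

Definition label X Y s : Prop :=
  [/\ Y s, ~ X s & forall t, sub true s t -> t <> s -> X t].

Lemma min_label X Y : lat X -> lat Y -> X `<=` Y -> X <> Y -> exists s, label X Y s.
Proof.
move=> lX lY XY nXY.
have [t [Yt nXt]] : exists t, Y t /\ ~ X t.
  apply: contrapT => h; apply: nXY; apply/seteqP; split=> // t Yt.
  by apply: contrapT => nXt; apply: h; exists t.
have [n] := ubnP (size t); elim: n t Yt nXt => // n IH t Yt nXt ltn.
have [h|h] := pselect (forall u, sub true t u -> u <> t -> X u); first by exists t.
apply: contrapT => nl; apply: h => u tu ut; apply: contrapT => nXu.
apply: nl; apply: (IH u) => //; first exact: latA Yt tu.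
have := sub_size tu; rewrite leq_eqVlt => /orP[/eqP e|]; last by lia.
by case: ut; apply: sub_size_eq tu _; rewrite e.
Qed.

Section CoverLabel.

Variables (X Y : set word).
Hypothesis cXY : covers lat subset X Y.

Let lX : lat X. Proof. by case: cXY. Qed.
Let lY : lat Y. Proof. by case: cXY. Qed.
Let XY : X `<=` Y. Proof. by case: cXY. Qed.

Lemma label_NE_bot s u : label X Y s -> sub false s u -> ~ X u.
Proof.
case=> Ys nXs hA su Xu; apply: nXs; apply: (concat_around lX Xu _ su hA).
exact: latS Ys.
Qed.

(** The right-hand side is closed, contains [X] and misses [s]; a cover leaves only [X] for it. *)
Lemma label_bot_perp s : label X Y s -> X = Y `&` perp s.
Proof.
move=> ls; have [Ys nXs hA] := ls.
have Ss := latS lY Ys.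
apply/esym/(cover_mid_bot cXY (lat_setI lY (lat_perp s)) _ _ Ys).
- move=> t Xt; split; [exact: XY|split; first exact: latS Xt].
  by move=> u tu su; apply: (label_NE_bot ls su); apply: latA Xt tu.
- by move=> t [].
- by case=> _ [_ /(_ s)]; apply; apply/sub_refl/Seg_ne.
Qed.

Lemma label_diff s t : label X Y s -> Y t -> ~ X t ->
  exists2 u, sub true t u & sub false s u.
Proof.
move=> ls Yt nXt; apply: contrapT => h; apply: nXt; rewrite (label_bot_perp ls).
split=> //; split; first exact: latS Yt.
by move=> u tu su; apply: h; exists u.
Qed.

Lemma cover_cc s : label X Y s -> Y = concats (X `|` sub true s).
Proof.
move=> [Ys nXs hA]; have Ss := latS lY Ys.
apply/esym/(cover_mid_top cXY _ _ _ _ nXs).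
- by apply: lat_join => //; apply: lat_sub.
- by move=> t Xt; apply: cc1; left.
- apply: cc_min; first by case: lY.
  by move=> t [/XY|] // st; apply: latA Ys st.
- by apply: cc1; right; apply/sub_refl/Seg_ne.
Qed.

Lemma label_NE_top s u : label X Y s -> sub false s u -> Y u -> u = s.
Proof.
move=> ls su Yu; have [Ys nXs hA] := ls; have Ss := latS lY Ys.
apply: (sub_size_eq su).
have [n] := ubnP (size u); elim: n u su Yu => // n IH u su Yu ltn.
have nXu := label_NE_bot ls su.
(* either [u] is itself a label or it can be shortened *)
have [[w [uw wu]]|h] := pselect (exists w, [/\ sub true u w, w <> u & ~ X w]).
  move=> nXw; have Yw := latA lY Yu uw.
  have [v wv sv] := label_diff ls Yw nXw.
  apply: leq_trans (IH v sv (latA lY Yw wv) _) _; last first.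
  - exact: leq_trans (sub_size wv) (sub_size uw).
  - have := sub_size wv.
    have : size w < size u; last by lia.
    by rewrite ltnNge; apply/negP => /(sub_size_eq uw).
have lu : label X Y u.
  by split=> // w uw wu; apply: contrapT => nXw; apply: h; exists w.
(* With [u] in the role of the label, [v] is an SW-subsegment of [s] and an NE-subsegment of [u],
   hence of [s]. So [v] is [s], and [u] is at least as long. *)
have [v sv uv] := label_diff lu Ys nXs.
have sv' : sub false s v by apply: sub_trans uv.
by rewrite (sub_both (Seg_uniq Ss) sv sv') in uv; apply: sub_size uv.
Qed.

Lemma label_sub s t : label X Y s -> Y t -> ~ X t -> sub true t s.
Proof.
move=> ls Yt nXt; have [u tu su] := label_diff ls Yt nXt.
by rewrite -(label_NE_top ls su (latA lY Yt tu)).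
Qed.

Lemma cover_cc1 s : label X Y s -> Y = concats (X `|` [set s]).
Proof.
move=> ls; have [Ys nXs hA] := ls; rewrite (cover_cc ls); congr concats.
apply/seteqP; split=> t [|]; try by left.
- move=> st; have [->|/eqP ts] := eqVneq t s; first by right.
  by left; apply: hA.
- by move=> ->; right; apply/sub_refl/Seg_ne/(latS lY).
Qed.

(** [Y] consists of the concatenations of members of [X] and copies of [s]. In such a decomposition
    of [s ++ w] a cut falls exactly after [s]: otherwise some piece would produce an NE-subsegment
    of [s] in [Y] other than [s], or put [s] into [X]. *)
Lemma label_E s w : label X Y s -> w != [::] -> jt false s w -> Y (s ++ w) -> Y w.
Proof.
move=> ls w0 jsw Ysw; have [Ys nXs hA] := ls.
have Ss := latS lY Ys; have s0 := Seg_ne Ss.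
have SX : X `|` [set s] `<=` Seg by move=> t [/(latS lX)|->].
have := Ysw; rewrite {1}(cover_cc1 ls).
(* scan the pieces covering [s], with [s'] the part of [s] still to cover *)
suff gen t : concats (X `|` [set s]) t -> forall s' w', t = s' ++ w' -> w' != [::] ->
    jt false s' w' -> s' != [::] ->
    (exists2 x, s = x ++ s' & jt false x s') -> s' = s /\ Y w'.
  by move=> /gen/(_ s w erefl w0 jsw s0) []//; exists [::].
have keyY s' : (exists2 x, s = x ++ s' & jt false x s') -> s' != [::] -> Y s' -> s' = s.
  move=> [x Ex jx] s'0; apply: label_NE_top => //.
  by rewrite Ex; apply: sub_suffix.
have mono t' : (X `|` [set s]) t' -> Y t' by move=> [/XY|->].
elim=> {t} [t tXs|a b aXs cb IH Sab] s' w' E w'0 js s'0 es.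
  have s's : s' = s.
    apply: keyY => //; apply: (latA lY (mono _ tXs)).
    by rewrite E; apply: sub_prefix.
  split=> //; case: tXs => [Xt|ts].
  - case: nXs; rewrite -s's; apply: (latA lX Xt); rewrite E.
    exact: sub_prefix.
  - move: E; rewrite ts s's => /(congr1 size); rewrite size_cat.
    by case: (w') w'0 => //= *; lia.
have a0 := Seg_ne (SX _ aXs).
have Yb : Y b by rewrite (cover_cc1 ls).
case: (cat_eq_cases E) => [[m Es' Eb]|[m [m0 Ea Ew']]].
- have [m0|m0] := eqVneq m [::].
    rewrite m0 cats0 in Es'; subst s'; split; first by apply: keyY => //; apply: mono.
    by rewrite m0 /= in Eb; rewrite -Eb.
  case: es => x Ex jx.
  case: (jt_either false a m) => j.
  + have [||ms _] := IH m w' Eb w'0 _ m0 _.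
    * by move: js; rewrite Es' jt_catl.
    * by exists (x ++ a); [rewrite -catA -Es'|rewrite jt_catl].
    * move: Ex; rewrite Es' ms => /(congr1 size); rewrite !size_cat.
      by case: (a) a0 => //= *; lia.
  + have sa : sub false s a.
      apply: (@sub_trans _ _ s'); first by rewrite Ex; apply: sub_suffix.
      by rewrite Es'; apply: sub_prefix.
    have := label_NE_top ls sa (mono _ aXs).
    move: Ex; rewrite Es' => /(congr1 size); rewrite !size_cat => e1 e2.
    by move: e1; rewrite -e2; case: (m) m0 => //= *; lia.
- have s's : s' = s.
    apply: keyY => //; apply: (latA lY (mono _ aXs)).
    by rewrite Ea; apply: sub_prefix => //; move: js; rewrite Ew' jt_catr.
  case: aXs => [Xa|as_].
  - case: nXs; rewrite -s's; apply: (latA lX Xa); rewrite Ea.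
    by apply: sub_prefix => //; move: js; rewrite Ew' jt_catr.
  - move: Ea; rewrite as_ s's => /(congr1 size); rewrite size_cat.
    by case: (m) m0 => //= *; lia.
Qed.

(** The mirror image of [label_E]. As [concats] adds pieces on the left, the scan from the right
    uses [cc_snoc] and induction on the length. *)
Lemma label_S s w : label X Y s -> w != [::] -> jt true w s -> Y (w ++ s) -> Y w.
Proof.
move=> ls w0 jws Yws; have [Ys nXs hA] := ls.
have Ss := latS lY Ys; have s0 := Seg_ne Ss.
have SX : X `|` [set s] `<=` Seg by move=> t [/(latS lX)|->].
have := Yws; rewrite {1}(cover_cc1 ls).
suff gen n t : size t < n -> concats (X `|` [set s]) t -> forall s' w', t = w' ++ s' ->
    w' != [::] -> jt true w' s' -> s' != [::] ->
    (exists2 x, s = s' ++ x & jt true s' x) -> s' = s /\ Y w'.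
  move=> /(gen _ _ (ltnSn _))/(_ s w erefl w0 jws s0) []//.
  by exists [::]; rewrite ?cats0 ?jt0r.
have keyY s' : (exists2 x, s = s' ++ x & jt true s' x) -> s' != [::] -> Y s' -> s' = s.
  move=> [x Ex jx] s'0; apply: label_NE_top => //.
  by rewrite Ex; apply: sub_prefix.
have mono t' : (X `|` [set s]) t' -> Y t' by move=> [/XY|->].
elim: n t => // n IH t ltn ct s' w' E w'0 js s'0 es.
case: (cc_snoc SX ct) => [tXs|[b [a [Et cb aXs]]]].
  have s's : s' = s.
    apply: keyY => //; apply: (latA lY (mono _ tXs)).
    by rewrite E; apply: sub_suffix.
  split=> //; case: tXs => [Xt|ts].
  - case: nXs; rewrite -s's; apply: (latA lX Xt); rewrite E.
    exact: sub_suffix.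
  - move: E; rewrite ts s's => /(congr1 size); rewrite size_cat.
    by case: (w') w'0 => //= *; lia.
have a0 := Seg_ne (SX _ aXs).
have Yb : Y b by rewrite (cover_cc1 ls).
have ltb : size b < n.
  by move: ltn; rewrite Et size_cat; case: (a) a0 => //= *; lia.
rewrite Et in E.
case: (cat_eq_cases E) => [[m Ew' Ea]|[m [m0 Eb Es']]].
- have [m0|m0] := eqVneq m [::].
    rewrite m0 cats0 /= in Ew' Ea; subst a w'.
    by split=> //; apply: keyY => //; apply: mono.
  have s's : s' = s.
    apply: keyY => //; apply: (latA lY (mono _ aXs)).
    by rewrite Ea; apply: sub_suffix => //; move: js; rewrite Ew' jt_catl.
  case: aXs => [Xa|as_].
  - case: nXs; rewrite -s's; apply: (latA lX Xa); rewrite Ea.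
    by apply: sub_suffix => //; move: js; rewrite Ew' jt_catl.
  - move: Ea; rewrite as_ s's => /(congr1 size); rewrite size_cat.
    by case: (m) m0 => //= *; lia.
- case: es => x Ex jx.
  case: (jt_either true m a) => j.
  + have [||ms _] := IH b ltb cb m w' Eb w'0 _ m0 _.
    * by move: js; rewrite Es' jt_catr.
    * by exists (a ++ x); [rewrite catA -Es'|rewrite jt_catr].
    * move: Ex; rewrite Es' ms => /(congr1 size); rewrite !size_cat.
      by case: (a) a0 => //= *; lia.
  + have sa : sub false s a.
      apply: (@sub_trans _ _ s'); first by rewrite Ex; apply: sub_prefix.
      by rewrite Es'; apply: sub_suffix.
    have := label_NE_top ls sa (mono _ aXs).
    move: Ex; rewrite Es' => /(congr1 size); rewrite !size_cat => e1 e2.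
    by move: e1; rewrite -e2; case: (m) m0 => //= *; lia.
Qed.

End CoverLabel.

End Segments.

Lemma size_cat3 a t b : size (a ++ t ++ b) = size t -> a = [::] /\ b = [::].
Proof. by rewrite !size_cat => e; split; apply: size0nil; lia. Qed.

(** * Semibricks *)

Section Wide.

Variable lam : {fset vertex}.
Implicit Types (X Y Z S T D : set word).

Local Notation Seg := (Seg lam).
Local Notation concats := (concats lam).

Definition semibrick D : Prop := D `<=` Seg /\
  forall d e u, D d -> D e -> sub true d u -> sub false e u -> d = e.

Lemma semibrick_eq D c d e u : semibrick D -> D d -> D e ->
  sub c d u -> sub (~~ c) e u -> d = e.
Proof.
by case=> _ h Dd De; case: c => [|su tu]; [apply: h|apply/esym; apply: h tu su].
Qed.

(** Whatever the colour of the joint after [e], the word [e] is a subsegment of [d] of one kind, and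
    it is a subsegment of itself of both kinds. *)
Lemma semibrick_prefix D d e m : semibrick D -> D d -> D e -> d = e ++ m -> m = [::].
Proof.
move=> sD Dd De E; have e0 := Seg_ne (sD.1 _ De).
have de : d = e.
  case: (jt_either false e m) => j.
  - apply: (semibrick_eq (c := true) (u := e) sD) => //; last exact: sub_refl.
    by rewrite E; apply: sub_prefix.
  - apply: (semibrick_eq (c := false) (u := e) sD) => //; last exact: sub_refl.
    by rewrite E; apply: sub_prefix.
by move/(congr1 size): E; rewrite de size_cat; case: (m) => //= *; lia.
Qed.

Lemma semibrick_suffix D d e m : semibrick D -> D d -> D e -> d = m ++ e -> m = [::].
Proof.
move=> sD Dd De E; have e0 := Seg_ne (sD.1 _ De).
have de : d = e.
  case: (jt_either true m e) => j.
  - apply: (semibrick_eq (c := true) (u := e) sD) => //; last exact: sub_refl.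
    by rewrite E; apply: sub_suffix.
  - apply: (semibrick_eq (c := false) (u := e) sD) => //; last exact: sub_refl.
    by rewrite E; apply: sub_suffix.
by move/(congr1 size): E; rewrite de size_cat; case: (m) => //= *; lia.
Qed.

Definition ccN D s : Prop := s = [::] \/ concats D s.

Lemma cc_uncons D s : concats D s -> exists d s', [/\ D d, s = d ++ s' & ccN D s'].
Proof.
case=> [d Dd|a b Da cb _]; first by exists d, [::]; rewrite cats0; split=> //; left.
by exists a, b; split=> //; right.
Qed.

Lemma cc_unsnoc D s : D `<=` Seg -> concats D s ->
  exists d s', [/\ D d, s = s' ++ d & ccN D s'].
Proof.
move=> DS /(cc_snoc DS)[Ds|[a [b [E ca Db]]]]; first by exists s, [::]; split=> //; left.
by exists b, a; split=> //; right.
Qed.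

Lemma cc_prefix D e x y : semibrick D -> D e -> concats D x -> e = x ++ y -> y = [::].
Proof.
move=> sD De /cc_uncons[f [x' [Df Ex _]]] E.
have := semibrick_prefix sD De Df; rewrite E Ex -catA => /(_ _ erefl) /eqP.
by rewrite cat_nil_eq => /andP[_ /eqP].
Qed.

(** A semibrick is a prefix code, so [s] and [s ++ t] begin with the same piece, which can be peeled
    off. The next lemma uses likewise that it is a suffix code. *)
Lemma cc_cancell D s t : semibrick D -> concats D s -> concats D (s ++ t) ->
  t != [::] -> concats D t.
Proof.
move=> sD.
have base d x : D d -> concats D (d ++ x) -> x != [::] -> concats D x.
  move=> Dd /cc_uncons[e [x' [De E cx']]] x0.
  case: (cat_eq_cases E) => [[m Ee Ex]|[m [m0 Ed Ex]]].
  - have m0 := semibrick_prefix sD De Dd Ee.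
    by move: Ex x0; rewrite m0 /= => ->; case: cx' => // ->.
  - by have := semibrick_prefix sD Dd De Ed => /eqP; rewrite (negbTE m0).
move=> cs; elim: cs t => {s} [d Dd|a b Da cb IH Sab] t; first exact: base.
rewrite -catA => /(base _ _ Da) h t0; apply: IH => //; apply: h.
by rewrite cat_nil_eq (negbTE t0) andbF.
Qed.

Lemma cc_cancelr D s t : semibrick D -> concats D t -> concats D (s ++ t) ->
  s != [::] -> concats D s.
Proof.
move=> sD; have DS := sD.1.
have base d x : D d -> concats D (x ++ d) -> x != [::] -> concats D x.
  move=> Dd /(cc_unsnoc DS)[e [x' [De E cx']]] x0.
  case: (cat_eq_cases E) => [[m Ex' Ed]|[m [m0 Ex Ee]]].
  - have m0 := semibrick_suffix sD Dd De Ed.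
    by move: Ex' x0; rewrite m0 cats0 => <-; case: cx' => // ->.
  - by have := semibrick_suffix sD De Dd Ee => /eqP; rewrite (negbTE m0).
have [n] := ubnP (size t); elim: n t => // n IH t ltn ct cst s0.
have [d [t' [Dd Et [t'0|ct']]]] := cc_unsnoc DS ct.
  by move: cst; rewrite Et t'0 => /base; apply.
apply: (IH t') => //.
  by move: ltn; rewrite Et size_cat; case: (d) (Seg_ne (DS _ Dd)) => //= *; lia.
by apply: (base d) => //; [rewrite -catA -Et|rewrite cat_nil_eq (negbTE s0)].
Qed.

(** If [s] and [t] are friendly along [u], then cuts of both decompositions fall at the ends of [u].
    This gives the condition on friendly segments and, with [t] equal to [u], the one on triple
    concatenations. The bound [n] makes it an induction hypothesis that [no_overlap] can share. *)
Definition cuts_align D n : Prop := forall c s t s1 u s3 t1 t3,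
  size s + size t < n -> concats D s -> concats D t ->
  s = s1 ++ u ++ s3 -> t = t1 ++ u ++ t3 -> u != [::] ->
  jt c s1 u -> jt (~~ c) u s3 -> jt (~~ c) t1 u -> jt c u t3 ->
  [/\ concats D u, ccN D s1 & ccN D t1].

(* At the first place where the two decompositions disagree, a common
   subsegment would violate the semibrick condition. *)
Lemma no_overlap D n c s1 d' m s3 t1 k t t3 :
  semibrick D -> cuts_align D n -> D (s1 ++ d') -> concats D (m ++ s3) -> concats D t ->
  t = t1 ++ (d' ++ m) ++ t3 -> D (t1 ++ d' ++ k) ->
  d' != [::] -> m != [::] -> k != [::] -> (forall j, jt j d' m = jt j d' k) ->
  jt c s1 d' -> jt (~~ c) t1 d' -> jt (~~ c) m s3 -> jt c m t3 ->
  size (m ++ s3) + size t < n -> False.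
Proof.
move=> sD IH Dd cs' ct Et De d'0 m0 k0 jmk j1 j2 j3 j4 ltn.
have DS := sD.1.
case: (jt_either c d' m) => j; last first.
  have [|||||_ _ ct1] := IH c (m ++ s3) t [::] m s3 (t1 ++ d') t3 ltn cs' ct erefl _ m0.
  - by rewrite Et !catA.
  - exact: jt0l.
  - by [].
  - by rewrite jt_catl.
  - by [].
  case: ct1 => [/eqP|ct1]; first by rewrite cat_nil_eq (negbTE d'0) andbF.
  have := cc_prefix sD De ct1 (catA _ _ _) => /eqP; by rewrite (negbTE k0).
have se : sub (~~ c) (t1 ++ d' ++ k) d' by exists t1, k; rewrite negbK -jmk.
have sd : sub c (s1 ++ d') d' by apply: sub_suffix.
have E := semibrick_eq sD Dd De sd se.
rewrite E in sd; have := sub_both (Seg_uniq (DS _ De)) sd se.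
move/(congr1 size); rewrite !size_cat; by case: (k) k0 => //=; clear; lia.
Qed.

Lemma cuts_align_all D n : semibrick D -> cuts_align D n.
Proof.
move=> sD; have DS := sD.1; have CS := cc_Seg DS.
elim: n => [|n IH] c s t s1 u s3 t1 t3 ltn cs ct Es Et u0 j1 j2 j3 j4 //.
have [d [s' [Dd Es' cs']]] := cc_uncons cs.
have [e [t' [De Et' ct']]] := cc_uncons ct.
have d0 := Seg_ne (DS _ Dd); have e0 := Seg_ne (DS _ De).
have Ss := CS _ cs; have St := CS _ ct.
have ccN_cons f m r : D f -> ccN D m -> Seg ((f ++ m) ++ r) -> ccN D (f ++ m).
  move=> Df [->|cm] Sg; right; first by rewrite cats0; apply: cc1.
  apply: cc_cons => //; apply: (Seg_catl Sg).
  by rewrite cat_nil_eq (negbTE (Seg_ne (DS _ Df))).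
have sz (f x : word) : f != [::] -> size x < size (f ++ x).
  by case: f => //= *; rewrite size_cat; lia.
have ucat m r : m ++ u ++ r != [::] by rewrite !cat_nil_eq (negbTE u0) andbF.
have Es2 : d ++ s' = s1 ++ u ++ s3 by rewrite -Es'.
have Et2 : e ++ t' = t1 ++ u ++ t3 by rewrite -Et'.
(* A first piece that ends before [u] begins is dropped. What remains is the case where [u] begins
   within both first pieces, [d = s1 ++ d'] and [e = t1 ++ e']. *)
case: (cat_eq_cases Es2) => [[m Es1 Es'2]|[d' [d'0 Ed Eu]]].
  have {}cs' : concats D s' by case: cs' => // E; have := ucat m s3; rewrite -Es'2 E.
  have [||cu cm ct1] := IH c s' t m u s3 t1 t3 _ cs' ct Es'2 Et u0 _ j2 j3 j4.
  - by move: ltn (sz d s' d0); rewrite -Es'; clear; lia.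
  - by have [->|m0] := eqVneq m [::]; [apply: jt0l|move: j1; rewrite Es1 jt_catl].
  split=> //; rewrite Es1; apply: (ccN_cons _ _ (u ++ s3)) => //.
  by rewrite -Es1 -Es.
case: (cat_eq_cases Et2) => [[m Et1 Et'2]|[e' [e'0 Ee Eu2]]].
  have {}ct' : concats D t' by case: ct' => // E; have := ucat m t3; rewrite -Et'2 E.
  have [||cu cs1 cm] := IH c s t' s1 u s3 m t3 _ cs ct' Es Et'2 u0 j1 j2 _ j4.
  - by move: ltn (sz e t' e0); rewrite -Et'; clear; lia.
  - by have [->|m0] := eqVneq m [::]; [apply: jt0l|move: j3; rewrite Et1 jt_catl].
  split=> //; rewrite Et1; apply: (ccN_cons _ _ (u ++ t3)) => //.
  by rewrite -Et1 -Et.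
have whole x y x' y' v : D (x ++ v ++ y) -> D (x' ++ v ++ y') -> v != [::] ->
    jt c x v -> jt (~~ c) v y -> jt (~~ c) x' v -> jt c v y' ->
    [/\ x = [::], y = [::], x' = [::], y' = [::] & D v].
  move=> D1 D2 v0 h1 h2 h3 h4.
  have s1' : sub c (x ++ v ++ y) v by exists x, y.
  have s2' : sub (~~ c) (x' ++ v ++ y') v by exists x', y'; rewrite negbK.
  have E := semibrick_eq sD D1 D2 s1' s2'.
  have s3' := s1'; rewrite E in s3'.
  have Ev := sub_both (Seg_uniq (DS _ D2)) s3' s2'.
  have [|-> ->] := @size_cat3 x v y; first by rewrite E -Ev.
  have [|-> ->] := @size_cat3 x' v y'; first by rewrite -Ev.
  by split=> //; move: D1; rewrite E -Ev.
have ltd : size s' + size t < n by move: ltn (sz d s' d0); rewrite -Es'; clear; lia.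
have lte : size s + size t' < n by move: ltn (sz e t' e0); rewrite -Et'; clear; lia.
have csN m : m != [::] -> s' = m ++ s3 -> concats D (m ++ s3).
  by move=> m0 E; rewrite -E; case: cs' => // E'; move: m0 E; rewrite E'; case: (m).
have ctN m : m != [::] -> t' = m ++ t3 -> concats D (m ++ t3).
  by move=> m0 E; rewrite -E; case: ct' => // E'; move: m0 E; rewrite E'; case: (m).
case: (cat_eq_cases Eu) => [[m Ed' Es3]|[m [m0 Eud Es'm]]].
- case: (cat_eq_cases Eu2) => [[k Ee' Et3]|[k [k0 Eue Et'k]]].
  + have [|||||||E1 E2 E3 E4 Du] := whole s1 m t1 k u.
    * by rewrite -Ed' -Ed.
    * by rewrite -Ee' -Ee.
    * by [].
    * by [].
    * by have [->|m0] := eqVneq m [::]; [apply: jt0r|move: j2; rewrite Es3 jt_catr].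
    * by [].
    * by have [->|k0] := eqVneq k [::]; [apply: jt0r|move: j4; rewrite Et3 jt_catr].
    * by rewrite E1 E3; split; [apply: cc1|left|left].
  + exfalso; apply: (@no_overlap D n (~~ c) t1 e' k t3 s1 (k ++ m) s s3) => //.
    * by rewrite -Ee.
    * exact: ctN.
    * by rewrite -Eue.
    * by rewrite (_ : e' ++ k ++ m = d') -?Ed // Ed' Eue catA.
    * by rewrite cat_nil_eq (negbTE k0).
    * by move=> j; rewrite jt_catr.
    * by move: j3; rewrite Eue jt_catr.
    * by rewrite negbK; move: j1; rewrite Eue jt_catr.
    * by rewrite negbK; move: j4; rewrite Eue jt_catl.
    * by move: j2; rewrite Eue jt_catl.
    * by move: lte; rewrite -Et'k addnC.
- case: (cat_eq_cases Eu2) => [[k Ee' Et3]|[k [k0 Eue Et'k]]].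
  + exfalso; apply: (@no_overlap D n c s1 d' m s3 t1 (m ++ k) t t3) => //.
    * by rewrite -Ed.
    * exact: csN.
    * by rewrite -Eud.
    * by rewrite (_ : d' ++ m ++ k = e') -?Ee // Ee' Eud catA.
    * by rewrite cat_nil_eq (negbTE m0).
    * by move=> j; rewrite jt_catr.
    * by move: j1; rewrite Eud jt_catr.
    * by move: j3; rewrite Eud jt_catr.
    * by move: j2; rewrite Eud jt_catl.
    * by move: j4; rewrite Eud jt_catl.
    * by rewrite -Es'm.
  (* Both first pieces end properly inside [u]. If they end together, [whole] makes the common part
     a member of [D], and the rest of [u] is left to the induction; otherwise [no_overlap] refutes
     the situation. *)
  + have E : d' ++ m = e' ++ k by rewrite -Eud.
    case: (cat_eq_cases E) => [[x Ee' Em]|[x [x0 Ed' Ek]]].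
    * have [x0|x0] := eqVneq x [::].
        rewrite x0 cats0 /= in Ee' Em; subst e' k.
        have [|||||||E1 _ E3 _ Du] := whole s1 [::] t1 [::] d'.
        - by rewrite cats0 -Ed.
        - by rewrite cats0 -Ee.
        - by [].
        - by move: j1; rewrite Eud jt_catr.
        - exact: jt0r.
        - by move: j3; rewrite Eud jt_catr.
        - exact: jt0r.
        have [|||||cm _ _] :=
          IH c s' t' [::] m s3 [::] t3 _ _ _ Es'm Et'k m0 (jt0l _ _) _ (jt0l _ _).
        - by move: ltd (sz e t' e0); rewrite -Et'; clear; lia.
        - by rewrite Es'm; apply: csN.
        - by rewrite Et'k; apply: ctN.
        - by move: j2; rewrite Eud jt_catl.
        - by move: j4; rewrite Eud jt_catl.
        rewrite E1 E3; split; [|by left|by left].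
        rewrite Eud; apply: cc_cons => //.
        rewrite -Eud; move: Ss; rewrite Es => /Seg_catr-/(_ (ucat [::] _)).
        by move/Seg_catl; apply.
      exfalso; apply: (@no_overlap D n c s1 d' m s3 t1 x t t3) => //.
      - by rewrite -Ed.
      - exact: csN.
      - by rewrite -Eud.
      - by rewrite -Ee' -Ee.
      - by move=> j; rewrite Em jt_catr.
      - by move: j1; rewrite Eud jt_catr.
      - by move: j3; rewrite Eud jt_catr.
      - by move: j2; rewrite Eud jt_catl.
      - by move: j4; rewrite Eud jt_catl.
      - by rewrite -Es'm.
    * exfalso; apply: (@no_overlap D n (~~ c) t1 e' k t3 s1 x s s3) => //.
      - by rewrite -Ee.
      - exact: ctN.
      - by rewrite -Eue.
      - by rewrite -Ed' -Ed.
      - by move=> j; rewrite Ek jt_catr.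
      - by move: j3; rewrite Eue jt_catr.
      - by rewrite negbK; move: j1; rewrite Eue jt_catr.
      - by rewrite negbK; move: j4; rewrite Eue jt_catl.
      - by move: j2; rewrite Eue jt_catl.
      - by move: lte; rewrite -Et'k addnC.
Qed.

End Wide.

(** * Wide sets *)

Section WideSets.

Variable lam : {fset vertex}.
Implicit Types (X Y Z S T D : set word).

Local Notation Seg := (Seg lam).
Local Notation concats := (concats lam).
Local Notation lat := (lat lam).

(** The cardinality condition is replaced by the three ways in which exactly two of [a], [b],
    [a ++ b] could belong to [T], each excluded. *)
Record wide_spec T : Prop := WideSpec {
  wide_Seg : T `<=` Seg;
  wide_cat : forall a b, T a -> T b -> Seg (a ++ b) -> T (a ++ b);
  wide_cancell : forall a b, T a -> T (a ++ b) -> b != [::] -> T b;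
  wide_cancelr : forall a b, T b -> T (a ++ b) -> a != [::] -> T a;
  wide_friendly : forall c s t u, T s -> T t -> sub c s u -> sub (~~ c) t u -> T u;
  wide_sides : forall c a s b, a != [::] -> b != [::] -> T (a ++ s ++ b) -> T s ->
    jt c a s -> jt (~~ c) s b -> T a /\ T b }.

Lemma semibrick_wide D : semibrick lam D -> wide_spec (concats D).
Proof.
move=> sD; have DS := sD.1; have CS := cc_Seg DS.
have side c s s1 u s3 t : concats D s -> concats D t -> s = s1 ++ u ++ s3 -> sub (~~ c) t u ->
    jt c s1 u -> jt (~~ c) u s3 -> concats D u /\ ccN lam D s1.
  move=> cs ct Es [t1 [t3 [Et u0 h1 h2]]] h3 h4; rewrite negbK in h2.
  by case: (cuts_align_all sD (ltnSn _) cs ct Es Et u0 h3 h4 h1 h2).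
split.
- exact: CS.
- exact: cc_app.
- by move=> a b; apply: cc_cancell.
- by move=> a b; apply: cc_cancelr.
- by move=> c s t u cs ct [s1 [s3 [Es _ h1 h2]]] tu; case: (side c _ _ _ _ _ cs ct Es tu h1 h2).
- move=> c a s b a0 b0 cab cs h1 h2.
  (* Here the common subsegment is all of [s], which is a subsegment of itself of either kind. *)
  have := side _ _ _ _ _ _ cab cs erefl (sub_refl (~~ c) (Seg_ne (CS _ cs))) h1 h2.
  case=> _ [/eqP|ca]; first by rewrite (negbTE a0).
  split=> //; apply: (cc_cancell sD cs) => //; apply: (cc_cancell sD ca) => //.
  by rewrite cat_nil_eq (negbTE b0) andbF.
Qed.

(** The semibrick consists of the members of [T] that are not composed of two members. By
    cancellation and the condition on the sides, a subsegment of such a member, of either kind and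
    lying in [T], is the whole of it; friendly ones share such a subsegment. *)
Lemma wide_semibrick T : wide_spec T -> exists2 D, semibrick lam D & T = concats D.
Proof.
move=> wT; have TS := wide_Seg wT.
pose D := [set s | T s /\ ~ exists a b, [/\ T a, T b & s = a ++ b]].
have wholeD c d u : D d -> T u -> sub c d u -> u = d.
  move=> [Td nd] Tu [a [b [E u0 h1 h2]]]; rewrite E in Td nd *.
  have [a0|a0] := eqVneq a [::].
    subst a; have [->|b0] := eqVneq b [::]; first by rewrite cats0.
    by case: nd; exists u, b; split=> //; apply: (wide_cancell wT Tu).
  have [b0|b0] := eqVneq b [::].
    subst b; case: nd; exists a, u; rewrite cats0 in Td *; split=> //.
    exact: (wide_cancelr wT Tu).
  have [Ta Tb] := wide_sides wT a0 b0 Td Tu h1 h2.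
  case: nd; exists a, (u ++ b); split=> //; apply: (wide_cat wT) => //.
  apply: (@Seg_catr _ a); first exact: TS.
  by rewrite cat_nil_eq (negbTE u0).
exists D.
- split; first by move=> s [/TS].
  move=> d e u Dd De du eu.
  have Tu : T u := wide_friendly wT Dd.1 De.1 du eu.
  by rewrite -(wholeD _ _ _ Dd Tu du) -(wholeD _ _ _ De Tu eu).
- apply/seteqP; split; last first.
    by apply: cc_min => [a b|s []//]; apply: (wide_cat wT).
  move=> s; have [n] := ubnP (size s); elim: n s => // n IH s ltn Ts.
  have [[a [b [Ta Tb E]]]|nd] := pselect (exists a b, [/\ T a, T b & s = a ++ b]).
    have [a0 b0] := (Seg_ne (TS _ Ta), Seg_ne (TS _ Tb)).
    rewrite E in ltn *; apply: cc_app; first by move=> ? [/TS].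
    + apply: IH => //; move: ltn b0; rewrite size_cat; case: (b) => //= *; lia.
    + apply: IH => //; move: ltn a0; rewrite size_cat; case: (a) => //= *; lia.
    + by rewrite -E; apply: TS.
  by apply: cc1.
Qed.

(** * Finiteness and the existence of covers *)

Fixpoint words n : seq word :=
  if n is n'.+1 then [::] :: [seq x :: w | x <- enum_fset lam, w <- words n']
  else [:: [::]].

Lemma mem_words n s : size s <= n -> all (mem lam) s -> s \in words n.
Proof.
elim: n s => [|n IH] [|x s] //= ltn /andP[xl sl].
by rewrite inE /=; apply/allpairsP; exists (x, s); split=> //=; apply: IH.
Qed.

(** A segment repeats no vertex, so it is no longer than the number of vertices of [lam]. *)
Lemma Seg_words s : Seg s -> s \in words #|` lam|.
Proof.
move=> Ss; have us := Seg_uniq Ss; case: Ss => _ /allP int_s _.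
have sl : all (mem lam) s by apply/allP => x /int_s /and5P[].
by apply: mem_words => //; apply: uniq_leq_size => // x /(allP sl).
Qed.

Definition mu X : nat := count (fun s => `[< X s >]) (words #|` lam|).

Lemma mu_lt X Y : X `<=` Y -> Y `<=` Seg -> X <> Y -> mu X < mu Y.
Proof.
move=> XY YS nXY.
have [t [Yt nXt]] : exists t, Y t /\ ~ X t.
  apply: contrapT => h; apply: nXY; apply/seteqP; split=> // t Yt.
  by apply: contrapT => nXt; apply: h; exists t.
have tw := Seg_words (YS _ Yt); rewrite /mu.
case/splitPr: tw => p1 p2; rewrite !count_cat /= (asboolF nXt) (asboolT Yt).
rewrite add0n add1n -addnS leq_add //.
  by apply: sub_count => s /asboolP /XY /asboolP.
by rewrite ltnS; apply: sub_count => s /asboolP /XY /asboolP.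
Qed.

Lemma exists_lower X Y : lat X -> lat Y -> X `<=` Y -> X <> Y ->
  exists2 Z, covers lat subset Z Y & X `<=` Z.
Proof.
move=> lX lY; have [n] := ubnP (mu Y - mu X); elim: n X lX => // n IH X lX ltn XY nXY.
have [[Z [lZ XZ ZY nXZ nZY]]|h] :=
    pselect (exists Z, [/\ lat Z, X `<=` Z, Z `<=` Y, Z <> X & Z <> Y]).
  have [|W cW ZW] := IH Z lZ _ ZY nZY; last by exists W => //; apply: subset_trans ZW.
  have /mu_lt : X `<=` Z by [].
  move=> /(_ (latS lZ)) h1; have := mu_lt ZY (latS lY) nZY.
  have : mu X < mu Z by apply: h1 => E; apply: nXZ.
  by move: ltn; clear; lia.
exists X => //; split=> // Z lZ XZ ZY.
have [->|/eqP n1] := eqVneq Z X; first by left.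
have [->|/eqP n2] := eqVneq Z Y; first by right.
by case: h; exists Z.
Qed.

Lemma exists_upper X Y : lat X -> lat Y -> X `<=` Y -> X <> Y ->
  exists2 Z, covers lat subset X Z & Z `<=` Y.
Proof.
move=> lX lY; have [n] := ubnP (mu Y - mu X); elim: n Y lY => // n IH Y lY ltn XY nXY.
have [[Z [lZ XZ ZY nXZ nZY]]|h] :=
    pselect (exists Z, [/\ lat Z, X `<=` Z, Z `<=` Y, Z <> X & Z <> Y]).
  have [||W cW WZ] := IH Z lZ _ XZ; last 1 first.
  - by exists W => //; apply: subset_trans ZY.
  - have h1 := mu_lt ZY (latS lY) nZY.
    have : mu X < mu Z by apply: mu_lt => //; [apply: latS|move=> E; apply: nXZ].
    by move: ltn h1; clear; lia.
  - by move=> E; apply: nXZ.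
exists Y => //; split=> // Z lZ XZ ZY.
have [->|/eqP n1] := eqVneq Z X; first by left.
have [->|/eqP n2] := eqVneq Z Y; first by right.
by case: h; exists Z.
Qed.

(* The meet of the elements covered by [X], but [X] itself if there are none. *)
Definition cover_meet X : set word :=
  [set s | X s /\ forall Y, covers lat subset Y X -> Y s].

Lemma cover_meet_lat X : lat X -> lat (cover_meet X).
Proof.
move=> lX; split.
- by move=> s [/(latS lX)].
- move=> s t [Xs h] st; split; first exact: (latA lX Xs st).
  by move=> Y cY; case: (cY) => lY _ _ _ _; apply: (latA lY (h Y cY) st).
- move=> a b [Xa ha] [Xb hb] Sab; split; first exact: (latC lX).
  by move=> Y cY; case: (cY) => lY _ _ _ _; apply: (latC lY (ha Y cY) (hb Y cY) Sab).
Qed.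

(** In terms of torsion classes this is the heart of the interval from [cover_meet X] to [X]: the
    members of [X] that are torsion-free with respect to [cover_meet X]. *)
Definition wide_of X : set word :=
  [set s | X s /\ forall u, sub false s u -> ~ cover_meet X u].

Definition lower_labels X : set word :=
  [set s | exists2 Y, covers lat subset Y X & label Y X s].

Lemma lower_labels_NE X d u : lower_labels X d -> sub false d u -> X u -> u = d.
Proof. by case=> Y cY ld; apply: label_NE_top cY _ _ ld. Qed.

Lemma semibrick_lower_labels X : lat X -> semibrick lam (lower_labels X).
Proof.
move=> lX; split; first by move=> d [Y _ [Xd _ _]]; apply: (latS lX Xd).
move=> d e u Dd De du eu.
have [Y cY [Xd nYd AY]] := Dd.
have [Z cZ [Xe nZe AZ]] := De.
have ue : u = e by apply: (lower_labels_NE De eu); apply: (latA lX Xd du).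
rewrite ue in du; have [->//|/eqP ned] := eqVneq d e.
have Ye : Y e by apply: AY du _ => E; apply: ned.
have [lY YX] : lat Y /\ Y `<=` X by case: cY.
have [lZ ZX] : lat Z /\ Z `<=` X by case: cZ.
have YZS : Y `|` Z `<=` Seg by move=> t [/(latS lY)|/(latS lZ)].
(* [e] lies in [Y] but not in [Z], so [X] is the join of the two. Hence [d] has an NE-subsegment in
   [Y] or [Z], necessarily [d] itself. It is not in [Y], and in [Z] it would bring [e] along. *)
have E : concats (Y `|` Z) = X.
  apply: (cover_mid_top cZ _ _ _ _ nZe).
  - exact: lat_join.
  - by move=> t Zt; apply: cc1; right.
  - by apply: cc_min; [case: lX|move=> t [/YX|/ZX]].
  - by apply: cc1; left.
have := Xd; rewrite -E => /(cc_piece false YZS)[v YZv dv].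
have vd : v = d.
  by apply: (lower_labels_NE Dd dv); case: YZv => [/YX|/ZX].
case: YZv; rewrite vd // => Zd; case: nZe; exact: (latA lZ Zd du).
Qed.

(** A segment [s] of the left side is missing from some lower cover, whose label [d] is then an
    SW-subsegment: [s = a ++ d ++ b]. The flanks are NE-subsegments of [s] and belong to [X] by
    [label_S] and [label_E], so induction applies to them. *)
Lemma wide_of_cc X : lat X -> wide_of X = concats (lower_labels X).
Proof.
move=> lX; have sD := semibrick_lower_labels lX; have DS := sD.1.
apply/seteqP; split.
- move=> s; have [n] := ubnP (size s); elim: n s => // n IH s ltn [Xs hs].
  have Ss := latS lX Xs.
  have : ~ cover_meet X s by apply: hs; apply: sub_refl (Seg_ne Ss).
  have [[Y [cY nYs]] _|h] := pselect (exists Y, covers lat subset Y X /\ ~ Y s); last first.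
    by case; split=> // Y cY; apply: contrapT => nYs; apply: h; exists Y.
  have [d ld] : exists d, label Y X d.
    by case: (cY) => lY _ YX nYX _; exact: (min_label lY lX YX nYX).
  have Dd : lower_labels X d by exists Y.
  have d0 := Seg_ne (DS _ Dd).
  have [a [b [E _ h1 h2]]] := label_sub cY ld Xs nYs.
  have Wab t : size t < size s -> sub false s t -> X t -> concats (lower_labels X) t.
    move=> lts st Xt; apply: IH; first exact: leq_trans lts _.
    by split=> // u tu; apply: hs; apply: sub_trans tu.
  have csb : b != [::] -> concats (lower_labels X) b.
    move=> b0; apply: Wab.
    - by rewrite E !size_cat; case: (d) d0 => //= *; lia.
    - by rewrite E catA; apply: sub_suffix; rewrite ?jt_catl.
    - apply: (label_E cY ld b0 h2); apply: (latA lX Xs).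
      rewrite E; apply: sub_suffix; first by rewrite cat_nil_eq (negbTE d0).
      by rewrite jt_catr.
  have csa : a != [::] -> concats (lower_labels X) a.
    move=> a0; apply: Wab.
    - by rewrite E !size_cat; case: (d) d0 => //= *; lia.
    - by rewrite E; apply: sub_prefix; rewrite ?jt_catr.
    - apply: (label_S cY ld a0 h1); apply: (latA lX Xs).
      rewrite E catA; apply: sub_prefix; first by rewrite cat_nil_eq (negbTE d0) andbF.
      by rewrite jt_catl.
  have cdb : concats (lower_labels X) (d ++ b).
    have [->|b0] := eqVneq b [::]; first by rewrite cats0; apply: cc1.
    apply: cc_cons => //; first exact: csb.
    move: Ss; rewrite E => /Seg_catr; apply.
    by rewrite cat_nil_eq (negbTE d0).
  rewrite E; have [->//|a0] := eqVneq a [::].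
  by apply: cc_app => //; [apply: csa|rewrite -E].
- have keyD d : lower_labels X d -> wide_of X d.
    move=> Dd; case: (Dd) => Y cY [Xd nYd _]; split=> // u du [Xu hu].
    by apply: nYd; rewrite -(lower_labels_NE Dd du Xu); apply: hu.
  apply: cc_min => // a b [Xa ha] [Xb hb] Sab; split; first exact: (latC lX).
  move=> u /sub_cat[au|bu|]; [exact: ha|exact: hb|].
  case=> t1 [t2 [a1 [b2 [[Et t10 t20] Ea Eb j1 j2]]]] Xu.
  have lm := cover_meet_lat lX.
  case: (jt_either true t1 t2) => j.
  + apply: (hb t2); first by rewrite Eb; apply: sub_prefix.
    by apply: (latA lm Xu); rewrite Et; apply: sub_suffix.
  + apply: (ha t1); first by rewrite Ea; apply: sub_suffix.
    by apply: (latA lm Xu); rewrite Et; apply: sub_prefix.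
Qed.

Definition SW_closure D : set word := concats [set t | exists2 d, D d & sub true d t].

Lemma SW_closure_lat D : D `<=` Seg -> lat (SW_closure D).
Proof.
move=> DS; apply: cc_lat; first by move=> t [d /DS Sd]; apply: Seg_sub.
by move=> s t [d Dd ds] st; exists d => //; apply: sub_trans st.
Qed.

Lemma SW_closure_sub D : D `<=` Seg -> D `<=` SW_closure D.
Proof. by move=> DS d Dd; apply: cc1; exists d => //; apply: sub_refl (Seg_ne (DS _ Dd)). Qed.

Lemma SW_closure_min D X : lat X -> D `<=` X -> SW_closure D `<=` X.
Proof.
move=> lX DX; apply: cc_min; first by case: lX.
by move=> t [d /DX Xd dt]; apply: (latA lX Xd dt).
Qed.

(* The canonical join representation of [SW_closure D] is [D]. *)
Lemma lower_labels_SW_closure D : semibrick lam D -> lower_labels (SW_closure D) = D.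
Proof.
move=> sD; have DS := sD.1; set X := SW_closure D.
have lX : lat X := SW_closure_lat DS.
have DX : D `<=` X := SW_closure_sub DS.
have ND d u : D d -> sub false d u -> X u -> u = d.
  move=> Dd du /(cc_piece false)[].
    by move=> t [e /DS Se]; apply: Seg_sub.
  move=> v [e De ev] uv; have dv := sub_trans du uv.
  have E := sD.2 _ _ _ De Dd ev dv; rewrite E in ev.
  apply: (sub_size_eq du); rewrite -(sub_both (Seg_uniq (DS _ Dd)) ev dv).
  exact: sub_size uv.
(* The lower cover with label [d], in the form dictated by [label_bot_perp]; it contains all other
   members of [D]. *)
pose P d := X `&` perp lam d.
have nPd d : D d -> ~ P d d.
  by move=> Dd [_ [_ /(_ d)]]; apply; apply: sub_refl (Seg_ne (DS _ Dd)).
have PX d : P d `<=` X by move=> t [].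
have lP d : lat (P d) by apply: lat_setI => //; apply: lat_perp.
have PA d t : D d -> sub true d t -> t <> d -> P d t.
  move=> Dd dt td; split; first exact: (latA lX (DX _ Dd) dt).
  split; first exact: (Seg_sub (DS _ Dd) dt).
  move=> u tu du; apply: td; apply: (sub_size_eq dt).
  rewrite -(ND _ _ Dd du (latA lX (DX _ Dd) (sub_trans dt tu))).
  exact: sub_size tu.
have up d Z : D d -> lat Z -> P d `<=` Z -> Z `<=` X -> ~ Z `<=` P d -> Z = X.
  move=> Dd lZ PZ ZX nZP; apply/seteqP; split=> //; apply: SW_closure_min => // e De.
  have [ne|/eqP ned] := eqVneq e d; last first.
    apply: PZ; split; first exact: DX.
    split; first exact: DS.
    by move=> u eu du; apply: ned; apply: sD.2 eu du.
  rewrite ne; apply: contrapT => nZd; apply: nZP => t Zt; split; first exact: ZX.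
  split; first exact: (latS lZ Zt).
  move=> u tu du; apply: nZd.
  by rewrite -(ND _ _ Dd du (latA lX (ZX _ Zt) tu)); apply: (latA lZ Zt tu).
have cP d : D d -> covers lat subset (P d) X.
  move=> Dd; split=> //; first by move=> E; apply: (nPd d Dd); rewrite E; apply: DX.
  move=> Z lZ PZ ZX; have [ZP|nZP] := pselect (Z `<=` P d); last by right; apply: (up d).
  by left; apply/seteqP.
apply/seteqP; split; last first.
  by move=> d Dd; exists (P d); [apply: cP|split; [apply: DX|apply: nPd|move=> t; apply: PA]].
move=> s [Y cY ls]; have [lY _ YX nYX _] := cY.
(* As [D] generates [X], a lower cover [Y] misses some [d] of [D]; then [Y] is [P d]. The labels [s]
   and [d] of this one cover are SW-subsegments of each other. *)
have [d [Dd nYd]] : exists d, D d /\ ~ Y d.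
  apply: contrapT => h; apply: nYX; apply/seteqP; split=> //.
  apply: SW_closure_min => // d Dd; apply: contrapT => nYd; apply: h.
  by exists d.
have YP : Y `<=` P d.
  move=> t Yt; split; first exact: YX.
  split; first exact: (latS lY Yt).
  move=> u tu du; apply: nYd.
  by rewrite -(ND _ _ Dd du (latA lX (YX _ Yt) tu)); apply: (latA lY Yt tu).
have [E|E] := cover_or_eq cY (lP d) YP (@PX d); last first.
  by case: (nPd d Dd); rewrite E; apply: DX.
have ld : label Y X d.
  by split=> //; [apply: DX|move=> t dt td; rewrite -E; apply: PA].
have [Xs nYs _] := ls.
have ds := label_sub cY ls (DX _ Dd) nYd.
by rewrite (sub_size_eq ds (sub_size (label_sub cY ld Xs nYs))).
Qed.

Lemma wide_specP T : wide_spec T <-> exists2 X, lat X & T = wide_of X.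
Proof.
split=> [/wide_semibrick[D sD ->]|[X lX ->]].
  exists (SW_closure D); first exact: SW_closure_lat sD.1.
  by rewrite wide_of_cc ?lower_labels_SW_closure //; apply: SW_closure_lat sD.1.
by rewrite wide_of_cc //; apply/semibrick_wide/semibrick_lower_labels.
Qed.

End WideSets.

(** * The conditions defining wide sets *)

Lemma card_eq2_setI3 (V : choiceType) (T : set V) (x y z : V) : uniq [:: x; y; z] ->
  (T `&` [set x; y; z] #= `I_2)%card <->
  `[< T x >] + `[< T y >] + `[< T z >] = 2.
Proof.
move=> us; pose l := seq.filter (fun v => `[< T v >]) [:: x; y; z].
have -> : T `&` [set x; y; z] = [set` [fset v in l]%fset].
  apply/seteqP; split=> v; rewrite /= in_fset mem_filter !inE.
    move=> [Tv vE]; rewrite asboolT //=.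
    by case: vE => [[->|->]|->]; rewrite eqxx ?orbT.
  by case/andP=> /asboolP Tv /or3P[] /eqP E; split=> //; rewrite E; auto.
have E : #|` [fset v in l]%fset| = `[< T x >] + `[< T y >] + `[< T z >].
  rewrite card_fseq undup_id ?filter_uniq // /l /=.
  by case: `[< T x >]; case: `[< T y >]; case: `[< T z >].
by split=> [/card_eq_fsetP|] h; [rewrite -E|apply/card_eq_fsetP; rewrite E].
Qed.

Lemma nbSE_neq (x : vertex) : nbE x != nbS x.
Proof. by apply/eqP => -[]; lia. Qed.

(** [jt] only tests for South; along a chain for [step], not South means East. *)
Lemma jt_step c a b : a != [::] -> b != [::] -> sorted step (a ++ b) ->
  jt c a b <-> head v0 b = (if c then nbS else nbE) (last v0 a).
Proof.
move=> a0 b0; rewrite sorted_cat // /jt (negbTE a0) (negbTE b0) /= => /and3P[_ + _].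
have n := nbSE_neq (last v0 a).
case/orP=> /eqP ->; case: c; rewrite ?eqxx ?(negbTE n) //=.
- by split=> // E; move: n; rewrite E eqxx.
- by split=> // E; move: n; rewrite E eqxx.
Qed.

Lemma jt_step' c a b : a != [::] -> b != [::] -> sorted step (a ++ b) ->
  jt c a b <-> last v0 a = (if c then nbN else nbW) (head v0 b).
Proof.
move=> a0 b0 sab; rewrite (jt_step c) //.
case: (last v0 a) (head v0 b) => [x y] [x' y'].
by case: c; rewrite /nbN /nbS /nbE /nbW /=; split=> -[-> ->]; congr pair; lia.
Qed.

Lemma head_irr t (x y : vertex) : t != [::] -> head x t = head y t.
Proof. by case: t. Qed.

Lemma last_irr t (x y : vertex) : t != [::] -> last x t = last y t.
Proof. by case: t. Qed.

Lemma enters_fromP c p t : sorted step p -> t != [::] ->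
  enters_from (if c then nbN else nbW) p t <->
  exists a b, [/\ p = a ++ t ++ b, a != [::] & jt c a t].
Proof.
move=> sp t0; split=> [[a [v [b [E Ev]]]]|[a [b [E a0 j]]]].
- exists (rcons a v), b; have r0 : rcons a v != [::] by case: (a).
  split=> //; apply/jt_step' => //.
  + by move: sp; rewrite E catA => /sorted_catl.
  + by rewrite last_rcons Ev (head_irr _ v0).
- have sat : sorted step (a ++ t) by move: sp; rewrite E catA => /sorted_catl.
  move/(jt_step' c a0 t0 sat): j E.
  case/lastP: (a) a0 => // a' v _; rewrite last_rcons => Ev E.
  by exists a', v, b; split=> //; rewrite (head_irr v v0).
Qed.

Lemma leaves_toP c p t : sorted step p -> t != [::] ->
  leaves_to (if c then nbS else nbE) p t <->
  exists a b, [/\ p = a ++ t ++ b, b != [::] & jt c t b].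
Proof.
move=> sp t0; split=> [[a [w [b [E Ew]]]]|[a [b [E b0 j]]]].
- exists a, (w :: b); split=> //; apply/jt_step => //.
  + by move: sp; rewrite E => /sorted_catr.
  + by rewrite /= Ew (last_irr _ v0).
- have stb : sorted step (t ++ b) by move: sp; rewrite E => /sorted_catr.
  move/(jt_step c t0 b0 stb): j E.
  case: (b) b0 => // w b' _ /= Ew E.
  by exists a, w, b'; split=> //; rewrite (last_irr w v0).
Qed.

Lemma enter_jt c s t : sorted step s -> t != [::] -> infix t s ->
  (prefix t s \/ enters_from (if c then nbN else nbW) s t) <->
  exists a b, s = a ++ t ++ b /\ jt c a t.
Proof.
move=> ss t0 ts; split=> [[/prefixP[b E]|/(enters_fromP c ss t0)]|[a [b [E j]]]].
- by exists [::], b.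
- by case=> a [b [E _ j]]; exists a, b.
- have [a0|a0] := eqVneq a [::].
    by left; apply/prefixP; exists b; rewrite E a0.
  by right; apply/(enters_fromP c ss t0); exists a, b.
Qed.

Lemma leave_jt c s t : sorted step s -> t != [::] -> infix t s ->
  (suffix t s \/ leaves_to (if c then nbS else nbE) s t) <->
  exists a b, s = a ++ t ++ b /\ jt c t b.
Proof.
move=> ss t0 ts; split=> [[/suffixP[a E]|/(leaves_toP c ss t0)]|[a [b [E j]]]].
- by exists a, [::]; rewrite cats0 jt0r.
- by case=> a [b [E _ j]]; exists a, b.
- have [b0|b0] := eqVneq b [::].
    by left; apply/suffixP; exists a; rewrite E b0 cats0.
  by right; apply/(leaves_toP c ss t0); exists a, b.
Qed.

Lemma subP c s t : sorted step s ->
  sub c s t <-> [/\ subsegment t s,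
    prefix t s \/ enters_from (if c then nbN else nbW) s t &
    suffix t s \/ leaves_to (if ~~ c then nbS else nbE) s t].
Proof.
move=> ss; split=> [[a [b [E t0 h1 h2]]]|[[/eqP t0 ts]]].
  have ts : infix t s by apply/infixP; exists a, b.
  split; first by split=> //; apply/eqP.
  - by apply/enter_jt => //; exists a, b.
  - by apply/leave_jt => //; exists a, b.
move=> /(enter_jt c ss t0 ts)[a [b [E h1]]] /(leave_jt (~~ c) ss t0 ts)[a' [b' [E' h2]]].
have [_ Eb] := uniq_cat_inj (sorted_step_uniq ss) t0 E E'.
by exists a, b; rewrite Eb in E *.
Qed.

Lemma SWsubP s t : sorted step s -> SWsub s t <-> sub true s t.
Proof. by move=> ss; rewrite (subP true t ss). Qed.

Lemma NEsubP s t : sorted step s -> NEsub s t <-> sub false s t.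
Proof. by move=> ss; rewrite (subP false t ss). Qed.

Section WideDefs.

Variable lam : {fset vertex}.
Implicit Types (X Y Z S T D : set word).

Local Notation Seg := (Seg lam).

Lemma Seg_sorted s : Seg s -> sorted step s. Proof. by case. Qed.

Lemma SWsubE s : Seg s -> SWsub s = sub true s.
Proof. by move=> /Seg_sorted ss; apply/seteqP; split=> t /(SWsubP t ss). Qed.

Lemma NEsubE s : Seg s -> NEsub s = sub false s.
Proof. by move=> /Seg_sorted ss; apply/seteqP; split=> t /(NEsubP t ss). Qed.

Lemma composableP a b : Seg a -> Seg b -> composable a b <-> Seg (a ++ b).
Proof.
move=> Sa Sb; have a0 := Seg_ne Sa; have b0 := Seg_ne Sb.
split=> [[a' [x [y [b' [Ea Eb st]]]]]|/Seg_sorted].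
  by apply: Seg_cat => //; rewrite Ea Eb last_rcons.
rewrite sorted_cat // => /and3P[_ + _].
case/lastP: (a) a0 => // a' x _; case: (b) b0 => // y b' _; rewrite last_rcons /= => st.
by exists a', x, y, b'.
Qed.

Lemma wideP T : wide lam T <-> wide_spec lam T.
Proof.
have cat_uniq a b : Seg a -> Seg b -> Seg (a ++ b) -> uniq [:: a; b; a ++ b].
  move=> Sa Sb Sab; have a0 := Seg_ne Sa; have b0 := Seg_ne Sb.
  rewrite /= !inE negb_or andbT -!andbA; apply/and3P; split; apply/eqP => E.
  - move/Seg_uniq: Sab; rewrite -E cat_uniq; case: (a) a0 => // x a' _ /and3P[_ + _].
    by rewrite /= inE eqxx.
  - move/(congr1 size): E; rewrite size_cat; case: (b) b0 => //= *; lia.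
  - move/(congr1 size): E; rewrite size_cat; case: (a) a0 => //= *; lia.
split=> [[TS h1 h2 h3]|wT].
- have cardT a b : Seg (a ++ b) -> a != [::] -> b != [::] ->
      `[< T a >] + `[< T b >] + `[< T (a ++ b) >] <> 2.
    move=> Sab a0 b0; have [Sa Sb] := (Seg_catl Sab a0, Seg_catr Sab b0).
    move=> /(card_eq2_setI3 T (cat_uniq _ _ Sa Sb Sab)); apply: h1 => //.
    exact/composableP.
  have ccat a b : T a -> T b -> Seg (a ++ b) -> T (a ++ b).
    move=> Ta Tb Sab; have := cardT _ _ Sab (Seg_ne (TS _ Ta)) (Seg_ne (TS _ Tb)).
    by rewrite (asboolT Ta) (asboolT Tb); case: asboolP.
  have ccl a b : T a -> T (a ++ b) -> b != [::] -> T b.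
    move=> Ta Tab b0; have := cardT _ _ (TS _ Tab) (Seg_ne (TS _ Ta)) b0.
    by rewrite (asboolT Ta) (asboolT Tab); case: asboolP.
  have ccr a b : T b -> T (a ++ b) -> a != [::] -> T a.
    move=> Tb Tab a0; have := cardT _ _ (TS _ Tab) a0 (Seg_ne (TS _ Tb)).
    by rewrite (asboolT Tb) (asboolT Tab); case: asboolP.
  split=> //.
  + move=> c s t u Ts Tt su tu; apply: (h2 s t u Ts Tt).
    have [Ss St] := (TS _ Ts, TS _ Tt).
    rewrite /friendly !SWsubE ?NEsubE //.
    by case: c su tu => su tu; [left|right].
  + move=> c a s b a0 b0 Tasb Ts j1 j2.
    have s0 := Seg_ne (TS _ Ts); have Sasb := TS _ Tasb.
    have sb0 : s ++ b != [::] by rewrite cat_nil_eq (negbTE s0).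
    have as0 : a ++ s != [::] by rewrite cat_nil_eq (negbTE s0) andbF.
    have Ssb := Seg_catr Sasb sb0.
    have Sas : Seg (a ++ s) by move: Sasb; rewrite catA => /Seg_catl; apply.
    have [Sa Sb] := (Seg_catl Sas a0, Seg_catr Ssb b0).
    apply: (h3 a s b) => //; [exact: TS|apply/composableP => //; exact: TS|
      apply/composableP => //; exact: TS|].
    rewrite SWsubE // NEsubE //.
    have : sub c (a ++ s ++ b) s by exists a, b.
    by case: (c); [left|right].
- have TS := wide_Seg wT; split=> //.
  + move=> s t Ss St /(composableP Ss St) Sst.
    move=> /(card_eq2_setI3 T (cat_uniq _ _ Ss St Sst)).
    have := wide_cat wT (a := s) (b := t); have := wide_cancell wT (a := s) (b := t).
    have := wide_cancelr wT (a := s) (b := t).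
    case: asboolP => Ts; case: asboolP => Tt; case: asboolP => Tst // h3' h2' h1' _.
    * by case: Tst; apply: h1'.
    * by case: Tt; apply: h2' => //; apply: Seg_ne St.
    * by case: Ts; apply: h3' => //; apply: Seg_ne Ss.
  + move=> s t r Ts Tt; have [Ss St] := (TS _ Ts, TS _ Tt).
    rewrite /friendly !SWsubE ?NEsubE // => -[[h h']|[h h']].
      exact: (wide_friendly wT (c := true) Ts Tt h h').
    exact: (wide_friendly wT (c := false) Ts Tt h h').
  + move=> s1 s2 s3 S1 S2 S3 c12 c23 T123 T2; have S123 := TS _ T123.
    rewrite SWsubE // NEsubE //.
    have gen c : sub c (s1 ++ s2 ++ s3) s2 -> T s1 /\ T s3.
      move=> [a [b [E _ j1 j2]]].
      have [Ea Eb] := uniq_cat_inj (Seg_uniq S123) (Seg_ne S2) erefl E.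
      move: j1 j2; rewrite -Ea -Eb => j1 j2.
      exact: (wide_sides wT (Seg_ne S1) (Seg_ne S3) T123 T2 j1 j2).
    by case=> /gen.
Qed.

End WideDefs.

(** * Paths *)

(* The analogue of [sub] for a segment in the inside of a path. *)
Definition psub c p t : Prop :=
  exists a b, [/\ p = a ++ t ++ b, a != [::], b != [::], t != [::] &
    jt c a t /\ jt (~~ c) t b].

Lemma psub_sub c p t u : psub c p t -> sub c t u -> psub c p u.
Proof.
case=> a [b [-> a0 b0 t0 [h1 h2]]] [a' [b' [E u0 h3 h4]]].
exists (a ++ a'), (b' ++ b); split=> //; rewrite ?cat_nil_eq ?(negbTE a0) ?(negbTE b0) ?andbF //.
  by rewrite E !catA.
split.
- have [E'|n0] := eqVneq a' [::]; last by rewrite jt_catl.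
  by move: h1; rewrite E E' /= cats0 jt_catr.
- have [E'|n0] := eqVneq b' [::]; last by rewrite jt_catr.
  by move: h2; rewrite E E' /= cats0 jt_catl.
Qed.

Lemma common_prefix s t : exists d z1 z2, [/\ s = d ++ z1, t = d ++ z2 &
  [\/ z1 = [::], z2 = [::] | head v0 z1 <> head v0 z2]].
Proof.
elim: s t => [|x s IH] [|y t]; try by exists [::], [::], [::]; split=> //; apply: Or31.
- by exists [::], [::], (y :: t); split=> //; apply: Or31.
- by exists [::], (x :: s), [::]; split=> //; apply: Or32.
have [->|/eqP xy] := eqVneq x y.
  by have [d [z1 [z2 [-> -> h]]]] := IH t; exists (y :: d), z1, z2.
by exists [::], (x :: s), (y :: t); split=> //; apply: Or33.
Qed.

Lemma common_suffix s t : exists d z1 z2, [/\ s = z1 ++ d, t = z2 ++ d &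
  [\/ z1 = [::], z2 = [::] | last v0 z1 <> last v0 z2]].
Proof.
have [d [z1 [z2 [E1 E2 h]]]] := common_prefix (rev s) (rev t).
exists (rev d), (rev z1), (rev z2); rewrite -!rev_cat -E1 -E2 !revK; split=> //.
have hl z : last v0 (rev z) = head v0 z by case: z => // x z; rewrite rev_cons last_rcons.
by case: h => [->|->|h]; [apply: Or31|apply: Or32|apply: Or33; rewrite !hl].
Qed.

Lemma diverge_jt c d z1 z2 : d != [::] -> z1 != [::] -> z2 != [::] ->
  sorted step (d ++ z1) -> sorted step (d ++ z2) -> head v0 z1 <> head v0 z2 ->
  jt c d z1 -> jt (~~ c) d z2.
Proof.
move=> d0 z10 z20 s1 s2 ne j1; rewrite jt_neg //; apply/negP => j2; apply: ne.
by move: j1 j2 => /(jt_step c d0 z10 s1) -> /(jt_step c d0 z20 s2) ->.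
Qed.

Lemma diverge_jt' c d z1 z2 : d != [::] -> z1 != [::] -> z2 != [::] ->
  sorted step (z1 ++ d) -> sorted step (z2 ++ d) -> last v0 z1 <> last v0 z2 ->
  jt c z1 d -> jt (~~ c) z2 d.
Proof.
move=> d0 z10 z20 s1 s2 ne j1; rewrite jt_neg //; apply/negP => j2; apply: ne.
by move: j1 j2 => /(jt_step' c z10 d0 s1) -> /(jt_step' c z20 d0 s2) ->.
Qed.

Section Paths.

Variable lam : {fset vertex}.
Implicit Types (X Y Z S T D F G : set word).

Local Notation Seg := (Seg lam).
Local Notation is_path := (is_path lam).
Local Notation interior := (interior lam).
Local Notation boundary := (boundary lam).

Lemma path_sorted_step p : is_path p -> sorted step p.
Proof. by case=> x [q [y []]]. Qed.

Lemma path_uniq p : is_path p -> uniq p.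
Proof. by move=> /path_sorted_step /sorted_step_uniq. Qed.

Lemma path_mid a t b : is_path (a ++ t ++ b) -> a != [::] -> t != [::] -> b != [::] ->
  Seg t.
Proof.
case=> x [q [y [E _ _ qi sp]]] a0 t0 b0.
have st : sorted step t by move: sp => /sorted_catr /sorted_catl.
case: (a) a0 E => // x' a' _.
case/lastP: (b) b0 => // b' y' _.
rewrite -!rcons_cat /= => -[_ /rcons_inj[E _]].
split=> //; first exact/eqP.
by move: qi; rewrite -E !all_cat => /and3P[].
Qed.

Lemma psub_Seg c p t : is_path p -> psub c p t -> Seg t.
Proof. by move=> ip [a [b [E a0 b0 t0 _]]]; rewrite E in ip; apply: path_mid ip _ _ _. Qed.

Lemma interior_lam v : interior v -> v \in lam. Proof. by case/and5P. Qed.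

Lemma path_lam p v : is_path p -> v \in p -> v \in lam.
Proof.
case=> x [q [y [-> /andP[xl _] /andP[yl _] /allP qi _]]].
rewrite inE mem_rcons inE => /or3P[/eqP->|/eqP->|/qi] //; exact: interior_lam.
Qed.

Lemma path_head_boundary p : is_path p -> boundary (head v0 p).
Proof. by case=> x [q [y [-> bx _ _ _]]]. Qed.

Lemma path_last_boundary p : is_path p -> boundary (last v0 p).
Proof. by case=> x [q [y [-> _ bl _ _]]]; rewrite /= last_rcons. Qed.

Lemma WS_NE_psub p q s : is_path p -> is_path q -> s != [::] ->
  WS_NE p q s <-> psub false p s /\ psub true q s.
Proof.
move=> ip iq s0.
have sp := path_sorted_step ip; have sq := path_sorted_step iq.
have gen c r : is_path r ->
  (enters_from (if c then nbN else nbW) r s /\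
   leaves_to (if ~~ c then nbS else nbE) r s) <-> psub c r s.
  move=> ir; have sr := path_sorted_step ir; split.
    case=> /(enters_fromP c sr s0)[a [b [E a0 j]]].
    move=> /(leaves_toP (~~ c) sr s0)[a' [b' [E' b'0 j']]].
    have [_ Eb] := uniq_cat_inj (path_uniq ir) s0 E E'.
    by exists a, b; rewrite Eb in E *.
  move=> [a [b [E a0 b0 _ [j j']]]]; split.
    by apply/(enters_fromP c sr s0); exists a, b.
  by apply/(leaves_toP (~~ c) sr s0); exists a, b.
rewrite /WS_NE -(gen false p ip) -(gen true q iq) /=.
by split=> [[]|[[? ?] [? ?]]].
Qed.

(** [bgood] and [fgood] are the two rules defining [p_e], for the edge [e] between [a] and [b]:
    going back from [e], and going forward from it. *)
Definition bgood X a : Prop := forall a1 a2, a = a1 ++ a2 ->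
  a1 != [::] -> a2 != [::] -> jt `[< X a2 >] a1 a2.

Definition fgood X b : Prop := forall b1 b2, b = b1 ++ b2 ->
  b1 != [::] -> b2 != [::] -> jt (~~ `[< X b1 >]) b1 b2.

Record epath X a b : Prop := EPath {
  epath_path : is_path (a ++ b);
  epath_l : a != [::];
  epath_r : b != [::];
  epath_jt : jt true a b;
  epath_b : bgood X a;
  epath_f : fgood X b }.

Lemma etaE X p : eta lam X p <->
  ~~ vertical p /\ exists a b, p = a ++ b /\ epath X a b.
Proof.
split=> [[nv [x [xl yl [ip [a [b [E hb hf]]]]]]]|[nv [a [b [E [ip a0 b0 j hb hf]]]]]].
- split=> //; exists (rcons a x), (nbS x :: b).
  have r0 : rcons a x != [::] by case: (a).
  rewrite E in ip; have sp := path_sorted_step ip; split=> //; split=> //.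
  + by apply/jt_step => //; rewrite last_rcons.
  + move=> a1 a2 Ea a10 a20; apply/jt_step' => //.
      by rewrite -Ea; apply: sorted_catl sp.
    case/lastP: a1 a10 Ea => // a' v _ /(hb _ _ _)/(_ _); rewrite last_rcons => ->; last exact/eqP.
    rewrite /in_mem /= /in_set; case: `[< _ >]; by rewrite (head_irr _ v0).
  + move=> b1 b2 Eb b10 b20; apply/jt_step => //.
      by rewrite -Eb; apply: sorted_catr sp.
    case: b2 b20 Eb => // w b' _ /(hf _ _ _)/(_ _) -> //=; last exact/eqP.
    rewrite /in_mem /= /in_set; case: `[< _ >]; by rewrite (last_irr _ v0).
- split=> //; rewrite E in nv *; have sp := path_sorted_step ip.
  have := (jt_step true a0 b0 sp).1 j.
  case/lastP: a a0 ip j hb nv sp E => // a x _ ip j hb nv sp E.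
  case: b b0 ip j hf nv sp E => // y b _ ip j hf nv sp E; rewrite last_rcons /= => yE.
  exists x; split.
  + by apply: (path_lam ip); rewrite mem_cat mem_rcons inE eqxx.
  + by apply: (path_lam ip); rewrite -yE mem_cat inE eqxx orbT.
  split=> //; exists a, b; rewrite -yE; split=> //.
  + move=> a' v d Ea /eqP d0; have r0 : rcons a' v != [::] by case: (a').
    have := hb _ _ Ea r0 d0 => /jt_step' -/(_ r0 d0); rewrite last_rcons => Ev.
    rewrite (head_irr v v0 d0) {1}Ev; last by rewrite -Ea; apply: sorted_catl sp.
    by rewrite /in_mem /= /in_set; case: `[< _ >].
  + move=> d w b' Eb /eqP d0.
    have := hf _ _ Eb d0 isT => /jt_step -/(_ d0 isT) /= Ew.
    rewrite (last_irr w v0 d0) {1}Ew; last by rewrite -Eb; apply: sorted_catr sp.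
    by rewrite /in_mem /= /in_set; case: `[< _ >].
Qed.
End Paths.

(** * Facets *)

Section Facets.

Variable lam : {fset vertex}.
Implicit Types (X Y Z S T D F G : set word).

Local Notation Seg := (Seg lam).
Local Notation concats := (concats lam).
Local Notation lat := (lat lam).
Local Notation is_path := (is_path lam).
Local Notation interior := (interior lam).
Local Notation boundary := (boundary lam).
Local Notation eta := (eta lam).
Local Notation epath := (epath lam).

Record sep X p : Prop := Sep {
  sep_path : is_path p;
  sep_nh : ~~ horizontal p;
  sep_nv : ~~ vertical p;
  sep_SW : forall t, psub true p t -> X t;
  sep_NE : forall t, psub false p t -> ~ X t }.

Lemma bgood_in X a a1 a2 : bgood X a -> a = a1 ++ a2 -> a1 != [::] -> a2 != [::] ->
  jt true a1 a2 -> X a2.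
Proof.
move=> h E a10 a20 j; apply: contrapT => nX; have := h _ _ E a10 a20.
by rewrite asboolF //; apply: (jt_contra a10 a20 j).
Qed.

Lemma bgood_out X a a1 a2 : bgood X a -> a = a1 ++ a2 -> a1 != [::] -> a2 != [::] ->
  jt false a1 a2 -> ~ X a2.
Proof.
move=> h E a10 a20 j Xa; have := h _ _ E a10 a20.
by rewrite asboolT //; apply: (jt_contra a10 a20 j).
Qed.

Lemma fgood_in X b b1 b2 : fgood X b -> b = b1 ++ b2 -> b1 != [::] -> b2 != [::] ->
  jt false b1 b2 -> X b1.
Proof.
move=> h E b10 b20 j; apply: contrapT => nX; have := h _ _ E b10 b20.
by rewrite asboolF //; apply: (jt_contra b10 b20 j).
Qed.

Lemma fgood_out X b b1 b2 : fgood X b -> b = b1 ++ b2 -> b1 != [::] -> b2 != [::] ->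
  jt true b1 b2 -> ~ X b1.
Proof.
move=> h E b10 b20 j Xb; have := h _ _ E b10 b20.
by rewrite asboolT //; apply: (jt_contra b10 b20 j).
Qed.

(** If [t] contains the edge, it is composed of a member of [X] before the edge and one after it. If
    not, extending [t] up to the edge gives a member of [X] of which [t] is an SW-subsegment. *)
Lemma epath_SW X a b t : lat X -> epath X a b -> psub true (a ++ b) t -> X t.
Proof.
move=> lX [ip a0 b0 j hb hf] [x [y [E x0 y0 t0 [h1 h2]]]].
have St : Seg t by rewrite E in ip; apply: path_mid ip _ _ _.
case: (cat_eq_cases E) => [[m Ex Eb]|[m [m0 Ea Em]]].
- have [m0|m0] := eqVneq m [::].
    rewrite m0 /= in Eb; exact: (fgood_in hf Eb t0 y0 h2).
  rewrite Ex jt_catl // in h1.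
  have Smt : Seg (m ++ t).
    move: ip; rewrite E Ex -!catA [m ++ _]catA => /path_mid.
    by apply; rewrite ?cat_nil_eq ?(negbTE m0).
  have mt0 : m ++ t != [::] by rewrite cat_nil_eq (negbTE m0).
  have Eb' : b = (m ++ t) ++ y by rewrite Eb catA.
  have Xmt : X (m ++ t) by apply: (fgood_in hf Eb' mt0 y0); rewrite jt_catl.
  by apply: (latA lX Xmt); apply: sub_suffix.
- case: (cat_eq_cases Em) => [[n Em' Ey]|[n [n0 Et Eb]]].
  + have Xm : X m by apply: (bgood_in hb Ea x0 m0); rewrite Em' jt_catr.
    have [n0|n0] := eqVneq n [::]; first by move: Xm; rewrite Em' n0 cats0.
    apply: (latA lX Xm); rewrite Em'; apply: sub_prefix => //.
    by move: h2; rewrite Ey jt_catr.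
  + have Xm : X m by apply: (bgood_in hb Ea x0 m0); move: h1; rewrite Et jt_catr.
    have Xn : X n by apply: (fgood_in hf Eb n0 y0); move: h2; rewrite Et jt_catl.
    by rewrite Et; apply: (latC lX) => //; rewrite -Et.
Qed.

(** If [t] avoids the edge, the part between them is in [X], and composing it with [t] would
    contradict the rules. If [t] contains the edge, its part after the edge is an SW-subsegment
    because the edge goes South, and this part is not in [X]. *)
Lemma epath_NE X a b t : lat X -> epath X a b -> psub false (a ++ b) t -> ~ X t.
Proof.
move=> lX [ip a0 b0 j hb hf] [x [y [E x0 y0 t0 [h1 h2]]]] Xt.
have St : Seg t by apply: latS Xt.
case: (cat_eq_cases E) => [[m Ex Eb]|[m [m0 Ea Em]]].
- have [m0|m0] := eqVneq m [::].
    by rewrite m0 /= in Eb; case: (fgood_out hf Eb t0 y0 h2).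
  rewrite Ex jt_catl // in h1.
  have mt0 : m ++ t != [::] by rewrite cat_nil_eq (negbTE m0).
  have Smt : Seg (m ++ t).
    by move: ip; rewrite E Ex -!catA [m ++ _]catA => /path_mid; apply.
  have Xm : X m.
    apply: (fgood_in hf Eb m0 _); first by rewrite cat_nil_eq (negbTE t0).
    by rewrite jt_catr.
  have Xmt := latC lX Xm Xt Smt.
  have Eb' : b = (m ++ t) ++ y by rewrite Eb catA.
  by apply: (fgood_out hf Eb' mt0 y0) Xmt; rewrite jt_catl.
- case: (cat_eq_cases Em) => [[n Em' Ey]|[n [n0 Et Eb]]].
  + have nXm : ~ X m by apply: (bgood_out hb Ea x0 m0); rewrite Em' jt_catr.
    have [n0|n0] := eqVneq n [::]; first by apply: nXm; rewrite Em' n0 cats0.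
    have Sm : Seg m by move: ip; rewrite Ea -catA => /path_mid; apply.
    have En : a = (x ++ t) ++ n by rewrite Ea Em' catA.
    have xt0 : x ++ t != [::] by rewrite cat_nil_eq (negbTE x0).
    have Xn : X n.
      apply: (bgood_in hb En xt0 n0).
      by rewrite jt_catl //; move: h2; rewrite Ey jt_catr.
    by apply: nXm; rewrite Em'; apply: (latC lX) => //; rewrite -Em'.
  + have Xn : X n.
      apply: (latA lX Xt); rewrite Et; apply: sub_suffix => //.
      by move: j; rewrite Ea Eb jt_catl // jt_catr.
    by apply: (fgood_out hf Eb n0 y0) Xn; move: h2; rewrite Et jt_catl.
Qed.

Lemma horizontal_jt a b : a != [::] -> b != [::] -> jt true a b -> ~~ horizontal (a ++ b).
Proof.
move=> a0 b0; rewrite /jt (negbTE a0) (negbTE b0) /= => /eqP/eqP h.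
apply/negP; rewrite /horizontal sorted_cat // h => /and3P[_ /eqP e _].
by have := nbSE_neq (last v0 a); rewrite e eqxx.
Qed.

Lemma vertical_jt a b : a != [::] -> b != [::] -> jt false a b -> ~~ vertical (a ++ b).
Proof.
move=> a0 b0; rewrite /jt (negbTE a0) (negbTE b0) /= => /eqP h.
by apply/negP; rewrite /vertical sorted_cat // h andbF.
Qed.

Lemma first_south p : sorted step p -> ~~ horizontal p ->
  exists a b, [/\ p = a ++ b, a != [::], b != [::], jt true a b &
    forall a1 a2, a = a1 ++ a2 -> a1 != [::] -> a2 != [::] -> jt false a1 a2].
Proof.
elim: p => [|x [|y p] IH] //= /andP[xy sp]; rewrite /horizontal /= negb_and.
have [yE|yE] := eqVneq y (nbE x); last first.
  move=> _; exists [:: x], (y :: p); split=> //.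
    by rewrite /jt /=; case/orP: xy => /eqP e; [rewrite e eqxx|rewrite e eqxx in yE].
  by move=> [|z [|z' a1]] a2 //= [_]; case: a2.
move=> /= nh; have [a [b [E a0 b0 j h]]] := IH sp nh.
case: a a0 E j h => // y' a _ [<- E] j h.
exists (x :: y :: a), b; split=> //; first by rewrite E.
move=> [|z a1] a2 //= [<- E2] _ a20.
have [a10|a10] := eqVneq a1 [::].
  move: E2; rewrite a10 /= => <-.
  by rewrite /jt [head _ _]/= [last _ _]/= yE (negbTE (nbSE_neq x)).
by rewrite (@jt_catl _ [:: _] a1) //; apply: h.
Qed.

Lemma sep_eta X p : lat X -> eta X p <-> sep X p.
Proof.
move=> lX; split.
  move=> /etaE[nv [a [b [E ep]]]]; rewrite {}E in nv *; have [ip a0 b0 j _ _] := ep.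
  split=> //; first exact: horizontal_jt.
  - by move=> t; apply: epath_SW.
  - by move=> t; apply: epath_NE.
move=> [ip nh nv hSW hNE]; apply/etaE; split=> //.
have sp := path_sorted_step ip.
have [a [b [E a0 b0 j h]]] := first_south sp nh.
have : bgood X a.
  move=> a1 a2 Ea a10 a20; case: asboolP => Xa2; last exact: h.
  case: (hNE a2) => //; exists a1, b; split=> //; first by rewrite E Ea catA.
  by split; [apply: h|move: j; rewrite Ea jt_catl].
clear h.
(* the last South step with a correct past has a correct future *)
have [n] := ubnP (size b); elim: n a b E a0 b0 j => // n IH a b E a0 b0 j ltn hb.
have [hf|nf] := pselect (fgood X b).
  by exists a, b; split=> //; split=> //; rewrite -E.
have [b1 [b2 [Eb b10 b20 nj]]] : exists b1 b2, [/\ b = b1 ++ b2, b1 != [::], b2 != [::] &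
    ~ jt (~~ `[< X b1 >]) b1 b2].
  apply: contrapT => nex; apply: nf => b1 b2 Eb b10 b20; apply: contrapT => nj.
  by apply: nex; exists b1, b2.
have jb1 : jt true a b1 by move: j; rewrite Eb jt_catr.
(* If [b1] were outside [X] it would be left to the East, hence be an SW-subsegment of [p]. So [b1]
   is in [X] and left to the South; this South step is the next candidate. *)
have [Xb1|nXb1] := pselect (X b1); last first.
  case: nj; rewrite asboolF //; case: (jt_either true b1 b2) => // j2.
  by case: nXb1; apply: hSW; exists a, b2; split=> //; rewrite E Eb.
move: nj; rewrite asboolT //= => nj.
have j2 : jt true b1 b2 by case: (jt_either true b1 b2) => // /nj.
have Sb1 := latS lX Xb1.
apply: (IH (a ++ b1) b2) => //.
- by rewrite -catA -Eb.
- by rewrite cat_nil_eq (negbTE a0).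
- by rewrite jt_catl.
- by move: ltn; rewrite Eb size_cat; case: (b1) b10 => //=; clear; lia.
(* The past of the new candidate is correct: a part [e] entered from the West is an NE-subsegment of
   [p]; one entered from the North is an SW-subsegment of [b1], or a member of [X] followed by
   [b1]. *)
move=> d e Ede d0 e0; case: (jt_either true d e) => jde; last first.
  rewrite asboolF // => Xe; apply: (hNE e _ Xe).
  exists d, b2; split=> //; first by rewrite E Eb catA Ede catA.
  split=> //; case: (cat_eq_cases Ede) => [[m _ Em]|[m [m0 _ Ee]]].
    by move: j2; rewrite Em jt_catl.
  by rewrite Ee jt_catl.
rewrite asboolT //; case: (cat_eq_cases Ede) => [[m Ed Em]|[m [m0 Ea Ee]]].
- have [m0|m0] := eqVneq m [::]; first by move: Xb1; rewrite Em m0.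
  apply: (latA lX Xb1); rewrite Em; apply: sub_suffix => //.
  by move: jde; rewrite Ed jt_catl.
- have Xm : X m.
    by apply: (bgood_in hb Ea d0 m0); move: jde; rewrite Ee jt_catr.
  rewrite Ee; apply: (latC lX) => //.
  have E2 : p = d ++ (m ++ b1) ++ b2 by rewrite E Ea Eb !catA.
  move: ip; rewrite E2 => /path_mid; apply=> //.
  by rewrite cat_nil_eq (negbTE m0).
Qed.

(** The part between two distinct candidate edges would be outside [X] by the forward rule at the
    first and inside [X] by the backward rule at the second. *)
Lemma epath_unique X a b a' b' : epath X a b -> epath X a' b' ->
  a ++ b = a' ++ b' -> a = a' /\ b = b'.
Proof.
have gen x y x' y' m : epath X x y -> epath X x' y' -> x' = x ++ m -> y = m ++ y' ->
    m = [::].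
  move=> [_ x0 y0 j hb hf] [_ x'0 y'0 j' hb' hf'] Ex Ey.
  apply/eqP/negPn/negP => m0.
  have jx : jt true x m by move: j; rewrite Ey jt_catr.
  have jy : jt true m y' by move: j'; rewrite Ex jt_catl.
  exact: (fgood_out hf Ey m0 y'0 jy) (bgood_in hb' Ex x0 m0 jx).
move=> e e' E; case: (cat_eq_cases E) => [[m Ea Eb]|[m [m0 Ea Eb]]].
- have m0 := gen _ _ _ _ _ e e' Ea Eb.
  by move: Ea Eb; rewrite m0 cats0 => -> ->.
- by move: m0; rewrite (gen _ _ _ _ _ e' e Ea Eb).
Qed.

(** * Existence of the paths through a vertical edge *)

Lemma rk_bound : exists N : nat, forall v, v \in lam -> (`|rk v| < N)%N.
Proof.
exists (\max_(v <- enum_fset lam) `|rk v|).+1%N => v vl.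
by rewrite ltnS; apply: (leq_bigmax_seq (F := fun v => `|rk v|%N)).
Qed.

(** The rule determines each step from the part already walked, recorded by [d]. From an interior
    vertex the walk can go on, and it stops because ranks are bounded on [lam]. The walk backwards
    is symmetric. *)
Lemma forward_path X v : v \in lam -> exists b y, [/\ head v0 (rcons b y) = v,
  all interior b, boundary y, sorted step (rcons b y) & fgood X (rcons b y)].
Proof.
have [N hN] := rk_bound => vl.
suff gen n d x : (Posz N - rk x <= Posz n)%R -> x \in lam ->
    exists b y, [/\ head v0 (rcons b y) = x, all interior b, boundary y,
      sorted step (rcons b y) & forall b1 b2, rcons b y = b1 ++ b2 ->
        b1 != [::] -> b2 != [::] -> jt (~~ `[< X (d ++ b1) >]) b1 b2].
  apply: (gen `|Posz N - rk v|%N [::]) => //; lia.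
elim: n d x => [|n IH] d x hx xl.
  by have := hN x xl; move: hx; clear; lia.
have [ix|nix] := boolP (interior x); last first.
  exists [::], x; split=> //; first by rewrite /Defs.boundary xl.
  by move=> [|z [|z' b1]] b2 //= [_]; case: b2.
pose w := if `[< X (rcons d x) >] then nbE x else nbS x.
have xw : step x w by rewrite /step /w; case: ifP; rewrite eqxx ?orbT.
have wl : w \in lam by rewrite /w; case: ifP; case/and5P: ix.
have [|b [y [hd ib by_ sb hb]]] := IH (rcons d x) w _ wl.
  by rewrite (step_rk xw); move: hx; clear; lia.
exists (x :: b), y; split=> //=; first by rewrite ix.
  by move: hd sb xw; case: (b) => [|z b'] /= -> => [_ ->|-> ->].
move=> [|z b1] b2 //= [<- E] _ b20.
have [b10|b10] := eqVneq b1 [::].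
  rewrite b10 cats1; move: E; rewrite b10 /= => <-.
  rewrite /jt /= (_ : rcons b y == [::] = false); last by case: (b).
  by rewrite hd /w; case: asboolP => _; rewrite ?eqxx // (negbTE (nbSE_neq x)).
by rewrite (@jt_catl _ [:: _] b1) // -cat_rcons; apply: hb.
Qed.

Lemma backward_path X v : v \in lam -> exists x a, [/\ last v0 (x :: a) = v,
  all interior a, boundary x, sorted step (x :: a) & bgood X (x :: a)].
Proof.
have [N hN] := rk_bound => vl.
suff gen n d x : (Posz N + rk x <= Posz n)%R -> x \in lam ->
    exists y a, [/\ last v0 (y :: a) = x, all interior a, boundary y,
      sorted step (y :: a) & forall a1 a2, y :: a = a1 ++ a2 ->
        a1 != [::] -> a2 != [::] -> jt `[< X (a2 ++ d) >] a1 a2].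
  have [|y [a [h1 h2 h3 h4 h5]]] := gen (absz (Posz N + rk v)%R) [::] v _ vl; first by lia.
  by exists y, a; split=> // a1 a2 E a10 a20; have := h5 _ _ E a10 a20; rewrite cats0.
elim: n d x => [|n IH] d x hx xl.
  by have := hN x xl; move: hx; clear; lia.
have [ix|nix] := boolP (interior x); last first.
  exists x, [::]; split=> //; first by rewrite /Defs.boundary xl.
  by move=> [|z [|z' a1]] a2 //= [_]; case: a2.
pose w := if `[< X (x :: d) >] then nbN x else nbW x.
have wS : nbS (nbN x) = x by case: (x) => i j; rewrite /nbS /nbN /=; congr pair; lia.
have wE : nbE (nbW x) = x by case: (x) => i j; rewrite /nbE /nbW /=; congr pair; lia.
have wx : step w x.
  by rewrite /step /w; case: ifP => _; rewrite ?wS ?wE eqxx ?orbT.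
have wl : w \in lam by rewrite /w; case: ifP; case/and5P: ix.
have [|y [a [ha ia by_ sa hb]]] := IH (x :: d) w _ wl.
  by move: hx; rewrite (step_rk wx); clear; lia.
exists y, (rcons a x); split=> //; first by rewrite /= last_rcons.
- by rewrite all_rcons ix.
- by rewrite /= rcons_path; move: sa ha => /= -> ->.
move=> a1 a2 + a10; case/lastP: a2 => // a2 z.
rewrite -rcons_cons -rcons_cat => /rcons_inj[E <-] _.
have [a20|a20] := eqVneq a2 [::].
  move: E; rewrite a20 cats0 => <-; rewrite /jt ha [head _ _]/= [rcons _ _]/= /w [_ ++ _]/=.
  case: asboolP => _; first by rewrite wS eqxx.
  by have := nbSE_neq (nbW x); rewrite wE => /negbTE ->.
by rewrite cat_rcons -cats1 jt_catr //; apply: hb.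
Qed.

Lemma exists_epath X (v : vertex) : v \in lam -> nbS v \in lam ->
  exists a b, [/\ epath X a b, last v0 a = v & head v0 b = nbS v].
Proof.
move=> /(backward_path X)[x [a [la ia bx sa hb]]] /(forward_path X)[b [y [hb' ib by_ sb hf]]].
have r0 : rcons b y != [::] by case: (b).
have ss : sorted step ((x :: a) ++ rcons b y).
  by rewrite sorted_cat // sa sb la hb' /step eqxx.
exists (x :: a), (rcons b y); split=> //; split=> //.
- exists x, (a ++ b), y; split=> //; first by rewrite /= rcons_cat.
  by rewrite all_cat ia.
- by apply/jt_step => //; rewrite hb' la.
Qed.

(** * Recovering a closed set from its facet *)

Definition SWs F : set word := [set t | exists2 p, F p & psub true p t].
Definition NEs F : set word := [set t | exists2 p, F p & psub false p t].

Lemma eta_path X p : eta X p -> is_path p.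
Proof. by case=> _ [u [_ _ []]]. Qed.

Lemma NEs_eta_Seg X : NEs (eta X) `<=` Seg.
Proof. by move=> t [p /eta_path ip]; apply: psub_Seg. Qed.

(** Take the path for the vertical edge that enters [s] from the North, and let [d] be its common
    prefix with [s]. If they part, the path turns East and [s] South, since otherwise [d] would be
    an SW-subsegment of [s] outside [X]. So [d] is an SW-subsegment of the path, and the rest of [s]
    is again in [X]. *)
Lemma SWs_eta_gen X s : lat X -> X s -> concats (SWs (eta X)) s.
Proof.
move=> lX; have [n] := ubnP (size s); elim: n s => // n IH s ltn Xs.
have Ss := latS lX Xs; have s0 := Seg_ne Ss.
have hs : interior (head v0 s).
  by case: Ss s0 => _ /allP is_ _; case: (s) is_ => // x s' is_ _; apply: is_; rewrite inE eqxx.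
have NS : nbS (nbN (head v0 s)) = head v0 s.
  by case: (head v0 s) => i j; rewrite /nbS /nbN /=; congr pair; lia.
have [||a [b [ep la hb]]] := @exists_epath X (nbN (head v0 s)).
- by case/and5P: hs.
- by rewrite NS; apply: interior_lam.
rewrite NS in hb; have [ip a0 b0 j hbg hfg] := ep.
have sp := path_sorted_step ip.
have jas d z : d != [::] -> s = d ++ z -> jt true a d.
  move=> d0 E; rewrite /jt la (negbTE a0) (negbTE d0) /=.
  by move: NS; rewrite E; case: (d) d0 => //= x d' _ ->; rewrite eqxx.
have etaP d z : b = d ++ z -> d != [::] -> z != [::] -> jt true a d -> jt false d z ->
    SWs (eta X) d.
  move=> E d0 z0 j1 j2; exists (a ++ b); last first.
    by exists a, z; rewrite E.
  apply/etaE; split; last by exists a, b.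
  by rewrite E catA; apply: vertical_jt => //; rewrite ?jt_catl // cat_nil_eq (negbTE d0) andbF.
have [d [z1 [z2 [Es Eb h]]]] := common_prefix s b.
have d0 : d != [::].
  apply/eqP => d0; move: Es Eb h hb; rewrite d0 /= => <- <- [E|E|ne] // hb'.
  - by rewrite E in s0.
  - by rewrite E in b0.
  - by apply: ne.
have jad : jt true a d := jas d z1 d0 Es.
have [z20|z20] := eqVneq z2 [::].
  have := path_last_boundary ip; rewrite last_cat Eb z20 cats0 /=.
  case/lastP: (d) d0 Es => // d' x _ Es; rewrite last_rcons => /andP[_ /negP[]].
  by case: Ss => _ /allP is_ _; apply: is_; rewrite Es mem_cat mem_rcons inE eqxx.
have [z10|z10] := eqVneq z1 [::].
  move: Es; rewrite z10 cats0 => Es; subst d.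
  apply: cc1; apply: (etaP _ _ Eb) => //.
  by have := hfg _ _ Eb d0 z20; rewrite asboolT.
have {h} ne : head v0 z1 <> head v0 z2 by case: h => // E; [rewrite E in z10|rewrite E in z20].
have sd1 : sorted step (d ++ z1) by rewrite -Es; case: Ss.
have sd2 : sorted step (d ++ z2) by rewrite -Eb; apply: sorted_catr sp.
have jd2 := hfg _ _ Eb d0 z20.
have [Xd|nXd] := pselect (X d).
  rewrite asboolT //= in jd2.
  have jd1 : jt true d z1.
    have := @diverge_jt false d z2 z1 d0 z20 z10 sd2 sd1; apply=> //.
    exact/nesym.
  rewrite Es; apply: cc_cons; first exact: etaP jd2.
    apply: IH; last by apply: (latA lX Xs); rewrite Es; apply: sub_suffix.
    by move: ltn; rewrite Es size_cat; case: (d) d0 => //=; clear; lia.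
  by rewrite -Es.
rewrite asboolF //= in jd2.
have jd1 : jt false d z1.
  have := @diverge_jt true d z2 z1 d0 z20 z10 sd2 sd1; apply=> //.
  exact/nesym.
by case: nXd; apply: (latA lX Xs); rewrite Es; apply: sub_prefix.
Qed.

(** Dual to [SWs_eta_gen], with the vertical edge that leaves [s] to the South and a common
    suffix. *)
Lemma NEs_eta_gen X s : lat X -> Seg s -> (forall u, sub false s u -> ~ X u) ->
  concats (NEs (eta X)) s.
Proof.
move=> lX; have [n] := ubnP (size s); elim: n s => // n IH s ltn Ss hs.
have s0 := Seg_ne Ss.
have ls : interior (last v0 s).
  case: Ss s0 => _ /allP is_ _; case/lastP: (s) is_ => // s' x is_ _.
  by rewrite last_rcons; apply: is_; rewrite mem_rcons inE eqxx.
have [||a [b [ep la hb]]] := @exists_epath X (last v0 s).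
- exact: interior_lam.
- by case/and5P: ls.
have [ip a0 b0 j hbg hfg] := ep.
have sp := path_sorted_step ip.
have etaP d z : a = z ++ d -> d != [::] -> z != [::] -> jt false z d ->
    NEs (eta X) d.
  move=> E d0 z0 j1; exists (a ++ b); last first.
    exists z, b; split=> //; first by rewrite E catA.
    by split=> //; move: j; rewrite E jt_catl.
  apply/etaE; split; last by exists a, b.
  by rewrite E -catA; apply: vertical_jt => //; rewrite ?jt_catr // cat_nil_eq (negbTE d0).
have [d [z1 [z2 [Es Ea h]]]] := common_suffix s a.
have d0 : d != [::].
  apply/eqP => d0; move: Es Ea h la; rewrite d0 !cats0 => <- <- [E|E|ne] // la'.
  - by rewrite E in s0.
  - by rewrite E in a0.
  - by apply: ne.
have [z20|z20] := eqVneq z2 [::].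
  have := path_head_boundary ip; rewrite Ea z20 /=.
  case: (d) d0 Es => // x d' _ Es /= /andP[_ /negP[]].
  by case: Ss => _ /allP is_ _; apply: is_; rewrite Es mem_cat inE eqxx orbT.
have [z10|z10] := eqVneq z1 [::].
  move: Es; rewrite z10 /= => Es; subst d.
  apply: cc1; apply: (etaP _ _ Ea) => //.
  have := hbg _ _ Ea z20 d0; rewrite asboolF //.
  exact/hs/sub_refl.
have {h} ne : last v0 z1 <> last v0 z2 by case: h => // E; [rewrite E in z10|rewrite E in z20].
have sd1 : sorted step (z1 ++ d) by rewrite -Es; case: Ss.
have sd2 : sorted step (z2 ++ d) by rewrite -Ea; apply: sorted_catl sp.
have jd2 := hbg _ _ Ea z20 d0.
have [Xd|nXd] := pselect (X d).
  rewrite asboolT //= in jd2.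
  have jd1 : jt false z1 d.
    have := @diverge_jt' true d z2 z1 d0 z20 z10 sd2 sd1; apply=> //.
    exact/nesym.
  by case: (hs d) => //; rewrite Es; apply: sub_suffix.
rewrite asboolF //= in jd2.
have jd1 : jt true z1 d.
  have := @diverge_jt' false d z2 z1 d0 z20 z10 sd2 sd1; apply=> //.
  exact/nesym.
rewrite Es; apply: cc_app; first exact: NEs_eta_Seg.
- apply: IH; first by move: ltn; rewrite Es size_cat; case: (d) d0 => //=; clear; lia.
    by rewrite Es in Ss; apply: (Seg_catl Ss).
  move=> u zu; apply: hs; apply: sub_trans zu; rewrite Es; exact: sub_prefix.
- by apply: cc1; apply: etaP jd2.
- by rewrite -Es.
Qed.

Definition lat_of F : set word := concats (SWs F).

Lemma face_path F p : face lam F -> F p -> is_path p.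
Proof. by case=> h _ /h[]. Qed.

Lemma SWs_Seg F : face lam F -> SWs F `<=` Seg.
Proof. by move=> fF t [p Fp]; apply: psub_Seg; apply: face_path Fp. Qed.

Lemma lat_of_lat F : face lam F -> lat (lat_of F).
Proof.
move=> fF; apply: cc_lat; first exact: SWs_Seg.
by move=> s t [p Fp ps] st; exists p => //; apply: psub_sub st.
Qed.

Lemma face_disj F t : face lam F -> SWs F t -> ~ NEs F t.
Proof.
move=> fF [p Fp pt] [q Fq qt].
have [ip iq] := (face_path fF Fp, face_path fF Fq).
have St := psub_Seg ip pt.
case: (fF) => _ /(_ q p Fq Fp); apply; exists t => //; left.
by apply/(WS_NE_psub iq ip (Seg_ne St)).
Qed.

(** Some piece of a concatenation is an NE-subsegment of it; were [t] in [lat_of F], two paths of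
    [F] would kiss along this piece. *)
Lemma NEs_lat_of F t : face lam F -> NEs F t -> ~ lat_of F t.
Proof.
move=> fF [p Fp pt] /(cc_piece false (SWs_Seg fF))[v SWv tv].
by apply: (face_disj fF SWv); exists p => //; apply: psub_sub tv.
Qed.

Lemma face_sub_eta F : face lam F -> F `<=` eta (lat_of F).
Proof.
move=> fF p Fp; apply/sep_eta; first exact: lat_of_lat.
case: (fF) => /(_ p Fp)[ip nh nv] _; split=> // t pt.
- by apply: cc1; exists p.
- by apply: NEs_lat_of => //; exists p.
Qed.

Lemma eta_face X : lat X -> face lam (eta X).
Proof.
move=> lX; split; first by move=> p /(sep_eta p lX)[].
move=> p q /(sep_eta p lX)[ip _ _ SWp NEp] /(sep_eta q lX)[iq _ _ SWq NEq].
move=> [s /Seg_ne s0 [/(WS_NE_psub ip iq s0)|/(WS_NE_psub iq ip s0)][h1 h2]].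
- exact: NEp h1 (SWq _ h2).
- exact: NEq h1 (SWp _ h2).
Qed.

Lemma lat_of_eta X : lat X -> lat_of (eta X) = X.
Proof.
move=> lX; apply/seteqP; split; last by move=> s; apply: SWs_eta_gen.
apply: cc_min; first by case: lX.
by move=> t [p /(sep_eta p lX)[_ _ _ SWp _] /SWp].
Qed.

Lemma lat_of_mono F G : F `<=` G -> lat_of F `<=` lat_of G.
Proof. by move=> FG; apply: cc_mono => t [p /FG Gp pt]; exists p. Qed.

(** If a larger face had a larger closed set, take a minimal new segment [s]. It is composed of
    NE-subsegments of paths of [eta X], and one of these pieces is an SW-subsegment of [s], hence in
    the larger closed set, against [NEs_lat_of]. *)
Lemma eta_facet X : lat X -> facet lam (eta X).
Proof.
move=> lX; split; first exact: eta_face.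
move=> G fG XG; apply/seteqP; split=> //.
have lG := lat_of_lat fG.
have XlG : X `<=` lat_of G by rewrite -{1}(lat_of_eta lX); apply: lat_of_mono.
suff -> : X = lat_of G by apply: face_sub_eta.
apply: contrapT => nXG; have [s [Gs nXs As]] := min_label lX lG XlG nXG.
have Ss := latS lG Gs.
have : concats (NEs (eta X)) s.
  apply: NEs_eta_gen => // u su Xu; apply: nXs.
  exact: concat_around lX Xu Ss su As.
move=> /(cc_piece true (@NEs_eta_Seg X))[v [p /XG Gp pv] sv].
by apply: (NEs_lat_of fG (t := v)); [exists p|apply: (latA lG Gs)].
Qed.

Lemma facet_eta F : facet lam F -> F = eta (lat_of F).
Proof.
move=> [fF mF]; apply/esym/mF; last exact: face_sub_eta.
exact: eta_face (lat_of_lat fF).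
Qed.

End Facets.

(** * Flips *)

Lemma sub_prefix_inv c a b : uniq (a ++ b) -> sub c (a ++ b) a -> jt (~~ c) a b.
Proof.
move=> us [x [y [E a0 h1 h2]]].
by have [_ ->] := uniq_cat_inj (a := [::]) us a0 erefl E.
Qed.

Lemma sub_suffix_inv c a b : uniq (a ++ b) -> sub c (a ++ b) b -> jt c a b.
Proof.
move=> us [x [y [E b0 h1 h2]]].
have E' : a ++ b = a ++ b ++ [::] by rewrite cats0.
by have [-> _] := uniq_cat_inj us b0 E' E.
Qed.

Section Flips.

Variable lam : {fset vertex}.
Implicit Types (X Y Z S T D F G : set word).

Local Notation Seg := (Seg lam).
Local Notation concats := (concats lam).
Local Notation lat := (lat lam).
Local Notation is_path := (is_path lam).
Local Notation interior := (interior lam).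
Local Notation boundary := (boundary lam).
Local Notation eta := (eta lam).
Local Notation epath := (epath lam).
Local Notation lat_of := (lat_of lam).

(** The rule is deterministic: where two walks back from the same vertex part, the same word would
    be both in [X] and outside it. *)
Lemma bgood_agree X a s : sorted step a -> sorted step s ->
  a != [::] -> s != [::] -> last v0 a = last v0 s -> bgood X a -> bgood X s ->
  (exists x, a = x ++ s) \/ (exists x, s = x ++ a).
Proof.
move=> sa ss a0 s0 la ba bs.
have [d [z1 [z2 [Ea Es h]]]] := common_suffix a s.
have d0 : d != [::].
  apply/eqP => d0; move: Ea Es; rewrite d0 !cats0 => E1 E2.
  by case: h => [E|E|]; [rewrite E1 E in a0|rewrite E2 E in s0|rewrite -E1 -E2].
have [z20|z20] := eqVneq z2 [::]; first by left; exists z1; rewrite Ea Es z20.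
have [z10|z10] := eqVneq z1 [::]; first by right; exists z2; rewrite Ea Es z10.
have ne : last v0 z1 <> last v0 z2 by case: h => // E; [rewrite E in z10|rewrite E in z20].
have j1 := ba _ _ Ea z10 d0; have j2 := bs _ _ Es z20 d0.
rewrite Ea in sa; rewrite Es in ss.
by case: (jt_contra z20 d0 j2 (diverge_jt' d0 z10 z20 sa ss ne j1)).
Qed.

Lemma fgood_agree X b s : sorted step b -> sorted step s ->
  b != [::] -> s != [::] -> head v0 b = head v0 s -> fgood X b -> fgood X s ->
  (exists y, b = s ++ y) \/ (exists y, s = b ++ y).
Proof.
move=> sb ss b0 s0 lb bb bs.
have [d [z1 [z2 [Eb Es h]]]] := common_prefix b s.
have d0 : d != [::].
  apply/eqP => d0; move: Eb Es; rewrite d0 /= => E1 E2.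
  by case: h => [E|E|]; [rewrite E1 E in b0|rewrite E2 E in s0|rewrite -E1 -E2].
have [z20|z20] := eqVneq z2 [::]; first by left; exists z1; rewrite Eb Es z20 cats0.
have [z10|z10] := eqVneq z1 [::]; first by right; exists z2; rewrite Eb Es z10 cats0.
have ne : head v0 z1 <> head v0 z2 by case: h => // E; [rewrite E in z10|rewrite E in z20].
have j1 := bb _ _ Eb d0 z10; have j2 := bs _ _ Es d0 z20.
rewrite Eb in sb; rewrite Es in ss.
by case: (jt_contra d0 z20 j2 (diverge_jt d0 z10 z20 sb ss ne j1)).
Qed.

Lemma path_boundary_l a d b : is_path (a ++ d ++ b) -> d != [::] -> b != [::] ->
  boundary (head v0 d) -> a = [::].
Proof.
move=> ip d0 b0 /andP[_ /negP bh]; apply/eqP/negPn/negP => a0; apply: bh.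
by have [_ + _] := path_mid ip a0 d0 b0; case: (d) d0 => //= x d' _ /andP[].
Qed.

Lemma path_boundary_r a d b : is_path (a ++ d ++ b) -> a != [::] -> d != [::] ->
  boundary (last v0 d) -> b = [::].
Proof.
move=> ip a0 d0 /andP[_ /negP bh]; apply/eqP/negPn/negP => b0; apply: bh.
have [_ + _] := path_mid ip a0 d0 b0; case/lastP: (d) d0 => // d' x _.
by rewrite all_rcons last_rcons => /andP[].
Qed.

(** One of [a] and [s] extends the other; the path starts at a boundary vertex while [s] is
    interior, so [a] is the longer one. *)
Lemma bgood_Seg X a b s : epath X a b -> Seg s -> last v0 a = last v0 s ->
  bgood X s -> exists2 x, x != [::] & a = x ++ s.
Proof.
move=> [ip a0 b0 _ ba _] Ss la bs; have s0 := Seg_ne Ss.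
have ih : ~ boundary (head v0 s).
  case: Ss s0 => _ is_ _; case: (s) is_ => //= x s' /andP[ix _] _.
  by rewrite /Defs.boundary ix andbF.
have bh := path_head_boundary ip.
have [||[x Ea]|[x Es]] := @bgood_agree X a s _ _ a0 s0 la ba bs.
- exact: sorted_catl (path_sorted_step ip).
- by case: Ss.
- exists x => //; apply/eqP => x0; apply: ih.
  by move: bh; rewrite Ea x0; case: (s) s0.
- case: ih; move: bh; rewrite Es; case: (x) Es => [|y x'] Es //=; first by case: (a) a0.
  by move: Ss; rewrite Es; case=> _ /= /andP[iy]; rewrite all_cat => /andP[_ +] _;
    case: (a) a0 => //= z a' _ /andP[iz _]; rewrite /Defs.boundary iz andbF.
Qed.

Lemma fgood_Seg X a b s : epath X a b -> Seg s -> head v0 b = head v0 s ->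
  fgood X s -> exists2 y, y != [::] & b = s ++ y.
Proof.
move=> [ip a0 b0 _ _ bb] Ss lb bs; have s0 := Seg_ne Ss.
have ih t : infix t s -> t != [::] -> ~ boundary (last v0 t).
  case: Ss => _ is_ _ /infixP[x [y E]]; move: is_; rewrite E !all_cat => /and3P[_ + _].
  case/lastP: t {E} => // t z; rewrite all_rcons last_rcons => /andP[iz _] _.
  by rewrite /Defs.boundary iz andbF.
have bl := path_last_boundary ip.
have [||[y Eb]|[y Es]] := @fgood_agree X b s _ _ b0 s0 lb bb bs.
- exact: sorted_catr (path_sorted_step ip).
- by case: Ss.
- exists y => //; apply/eqP => y0; apply: (ih s); rewrite ?infix_refl //.
  by move: bl; rewrite Eb y0 cats0 last_cat; case: (s) s0.
- case: (ih b) => //; first by rewrite Es prefix_infix.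
  by move: bl; rewrite last_cat; case: (b) b0.
Qed.

Lemma epath_det X a b a' b' : epath X a b -> epath X a' b' ->
  last v0 a = last v0 a' -> head v0 b = head v0 b' -> a = a' /\ b = b'.
Proof.
move=> [ip a0 b0 _ ba bb] [ip' a'0 b'0 _ ba' bb'] la hb.
have sp := path_sorted_step ip; have sp' := path_sorted_step ip'.
have hd z z' : z != [::] -> head v0 (z ++ z') = head v0 z by case: z.
have lst z z' : z != [::] -> last v0 (z' ++ z) = last v0 z by rewrite last_cat; case: z.
split.
- have [[x E]|[x E]] := bgood_agree (sorted_catl sp) (sorted_catl sp') a0 a'0 la ba ba'.
    rewrite E -catA in ip; rewrite E (path_boundary_l ip) //.
    by rewrite -(hd a' b') //; apply: path_head_boundary.
  rewrite E -catA in ip'; rewrite E (path_boundary_l ip') //.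
  by rewrite -(hd a b) //; apply: path_head_boundary.
- have [[y E]|[y E]] := fgood_agree (sorted_catr sp) (sorted_catr sp') b0 b'0 hb bb bb'.
    rewrite E in ip; rewrite E (path_boundary_r ip) ?cats0 //.
    by rewrite -(lst b' a') //; apply: path_last_boundary.
  rewrite E in ip'; rewrite E (path_boundary_r ip') ?cats0 //.
  by rewrite -(lst b a) //; apply: path_last_boundary.
Qed.

Section CoverFlip.

Variables (X Y : set word) (s : word).
Hypotheses (cXY : covers lat subset X Y) (ls : label X Y s).

Let lX : lat X. Proof. by case: cXY. Qed.
Let lY : lat Y. Proof. by case: cXY. Qed.
Let XY : X `<=` Y. Proof. by case: cXY. Qed.
Let Ys : Y s. Proof. by case: ls. Qed.
Let nXs : ~ X s. Proof. by case: ls. Qed.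
Let Ss : Seg s. Proof. exact: latS Ys. Qed.
Let s0 : s != [::]. Proof. exact: Seg_ne Ss. Qed.

(** The label obeys the backward rule for [X] and the forward rule for [Y]. So the path of [X] for
    the vertical edge below the last vertex of [s], and the path of [Y] for the one above its first
    vertex, both run along [s]. *)
Lemma label_bgood : bgood X s.
Proof.
move=> z d E z0 d0; have ds : d <> s.
  by move/(congr1 size); rewrite E size_cat; case: (z) z0 => //= x z' _; clear; lia.
case: (jt_either true z d) => j.
- rewrite asboolT //; case: ls => _ _; apply=> //.
  by rewrite E; apply: sub_suffix.
- rewrite asboolF //; apply: (label_NE_bot cXY ls).
  by rewrite E; apply: sub_suffix.
Qed.

Lemma label_fgood : fgood Y s.
Proof.
move=> d z E d0 z0; have ds : d <> s.
  by move/(congr1 size); rewrite E size_cat; case: (z) z0 => //= x z' _; clear; lia.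
case: (jt_either true d z) => j.
- rewrite asboolF // => Yd; apply: ds; apply: (label_NE_top cXY ls) => //.
  by rewrite E; apply: sub_prefix.
- rewrite asboolT //; apply: (latA lY Ys); rewrite E; exact: sub_prefix.
Qed.

Lemma flip_down : exists x y, [/\ epath X (x ++ s) y, x != [::] & jt false x s].
Proof.
have ils : interior (last v0 s).
  case: Ss s0 => _ + _; case/lastP: s => // t z.
  by rewrite all_rcons last_rcons => /andP[].
have [||a [b [ep la hb]]] := @exists_epath lam X (last v0 s).
- exact: interior_lam.
- by case/and5P: ils.
have [x x0 Ea] := bgood_Seg ep Ss la label_bgood.
exists x, b; rewrite -Ea; split=> //.
by have := epath_b ep Ea x0 s0; rewrite asboolF.
Qed.

Lemma flip_up : exists x y, [/\ epath Y x (s ++ y), y != [::] & jt false s y].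
Proof.
have ihs : interior (head v0 s).
  by case: Ss s0 => _ + _; case: s => //= z t /andP[].
have NS : nbS (nbN (head v0 s)) = head v0 s.
  by case: (head v0 s) => i j; rewrite /nbS /nbN /=; congr pair; lia.
have [||a [b [ep la hb]]] := @exists_epath lam Y (nbN (head v0 s)).
- by case/and5P: ihs.
- by rewrite NS; apply: interior_lam.
rewrite NS in hb; have [y y0 Eb] := fgood_Seg ep Ss hb label_fgood.
exists a, y; rewrite -Eb; split=> //.
by have := epath_f ep Eb s0 y0; rewrite asboolT.
Qed.

Lemma label_prefix w : Seg (s ++ w) -> w != [::] -> Y (s ++ w) -> ~ X (s ++ w) ->
  jt false s w.
Proof.
move=> Sw w0 Yw nXw; apply: (sub_prefix_inv (c := true)); first exact: Seg_uniq Sw.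
exact: (label_sub cXY ls Yw nXw).
Qed.

Lemma label_suffix w : Seg (w ++ s) -> w != [::] -> Y (w ++ s) -> ~ X (w ++ s) ->
  jt true w s.
Proof.
move=> Sw w0 Yw nXw; apply: sub_suffix_inv; first exact: Seg_uniq Sw.
exact: (label_sub cXY ls Yw nXw).
Qed.

(** A path of [eta X] with NE-subsegment [s] must be the one for the edge leaving [s] to the South,
    so it is unique. A part next to [s] breaking the rule would combine with [s] to a segment of [Y]
    outside [X]; this would have [s] as an SW-subsegment, against the colour of the joint. *)
Lemma sep_NE_epath x y : sep lam X (x ++ s ++ y) -> x != [::] -> y != [::] ->
  jt false x s -> jt true s y -> epath X (x ++ s) y.
Proof.
move=> [ip _ _ SWr NEr] x0 y0 j1 j2.
have ss0 z : z ++ s != [::] by rewrite cat_nil_eq (negbTE s0) andbF.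
split=> //; first by rewrite -catA.
- by rewrite jt_catl.
- move=> a1 a2 E a10 a20; case: (cat_eq_cases E) => [[m Ea1 Es]|[m [m0 Ex Ea2]]].
    have [m0|m0] := eqVneq m [::].
      by move: Es; rewrite Ea1 m0 cats0 /= => <-; rewrite asboolF.
    by rewrite Ea1 jt_catl //; apply: label_bgood.
  have E3 : x ++ s ++ y = a1 ++ (m ++ s) ++ y by rewrite Ex !catA.
  have Sms : Seg (m ++ s) by rewrite E3 in ip; apply: path_mid ip _ _ _.
  have jms : jt false m s by move: j1; rewrite Ex jt_catl.
  rewrite Ea2 jt_catr //; case: (jt_either true a1 m) => j.
  + rewrite asboolT //; apply: contrapT => nX.
    have Xm : X m.
      apply: SWr; exists a1, (s ++ y); rewrite Ex -catA; split=> //.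
        by rewrite cat_nil_eq (negbTE s0).
      by rewrite jt_catr.
    have := label_suffix Sms m0 (latC lY (XY Xm) Ys Sms) nX.
    exact: jt_contra jms.
  + rewrite asboolF //; apply: NEr; exists a1, y; split=> //.
    by rewrite jt_catr // jt_catl.
- move=> b1 b2 E b10 b20; case: (jt_either true b1 b2) => j.
    rewrite asboolF // => Xb1.
    have E3 : x ++ s ++ y = x ++ (s ++ b1) ++ b2 by rewrite E !catA.
    have sb0 : s ++ b1 != [::] by rewrite cat_nil_eq (negbTE s0).
    have Ssb : Seg (s ++ b1) by rewrite E3 in ip; apply: path_mid ip _ _ _.
    have jsb : jt true s b1 by move: j2; rewrite E jt_catr.
    have nX : ~ X (s ++ b1).
      apply: NEr; exists x, b2; split=> //.
      by rewrite jt_catr // jt_catl.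
    have := label_prefix Ssb b10 (latC lY Ys (XY Xb1) Ssb) nX.
    exact: (jt_contra s0 b10 jsb).
  rewrite asboolT //; apply: SWr; exists (x ++ s), b2; rewrite E -catA; split=> //.
  by rewrite jt_catl //; move: j2; rewrite E jt_catr.
Qed.

Lemma sep_SW_epath x y : sep lam Y (x ++ s ++ y) -> x != [::] -> y != [::] ->
  jt true x s -> jt false s y -> epath Y x (s ++ y).
Proof.
move=> [ip _ _ SWr NEr] x0 y0 j1 j2.
split=> //; first by rewrite cat_nil_eq (negbTE s0).
- by rewrite jt_catr.
- move=> a1 a2 E a10 a20.
  have jas : jt true a2 s by move: j1; rewrite E jt_catl.
  have E3 : x ++ s ++ y = a1 ++ (a2 ++ s) ++ y by rewrite E !catA.
  case: (jt_either true a1 a2) => j.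
  + rewrite asboolT //; apply: (label_S cXY ls a20 jas).
    apply: SWr; exists a1, y; split=> //; first by rewrite cat_nil_eq (negbTE a20).
    by rewrite jt_catr // jt_catl.
  + rewrite asboolF //; apply: NEr; exists a1, (s ++ y); rewrite E -catA; split=> //.
      by rewrite cat_nil_eq (negbTE s0).
    by rewrite jt_catr.
- move=> b1 b2 E b10 b20; case: (cat_eq_cases E) => [[m Eb1 Ey]|[m [m0 Es Eb2]]].
    have [m0|m0] := eqVneq m [::].
      by rewrite Eb1 m0 cats0 asboolT //; move: j2; rewrite Ey m0.
    have jsm : jt false s m by move: j2; rewrite Ey jt_catr.
    have E3 : x ++ s ++ y = x ++ (s ++ m) ++ b2 by rewrite Ey !catA.
    rewrite Eb1 jt_catl //; case: (jt_either true m b2) => j.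
    + rewrite asboolF // => /(label_E cXY ls m0 jsm); apply: NEr.
      by exists (x ++ s), b2; rewrite Ey -catA cat_nil_eq (negbTE x0) jt_catl.
    + rewrite asboolT //; apply: SWr; exists x, b2; split=> //.
        by rewrite cat_nil_eq (negbTE s0).
      by rewrite jt_catr // jt_catl.
  by rewrite Eb2 jt_catr //; apply: label_fgood.
Qed.

(** A path of [eta X] survives in [eta Y] unless [s] is an NE-subsegment of it, and a path of
    [eta Y] comes from [eta X] unless [s] is an SW-subsegment of it. There is exactly one exception
    of each sort. *)
Lemma cover_flip_paths : exists x y x' y',
  let p := (x ++ s) ++ y in let q := x' ++ s ++ y' in
  [/\ epath X (x ++ s) y, epath Y x' (s ++ y'),
      eta X p /\ ~ eta Y p, eta Y q /\ ~ eta X q &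
      [/\ eta X `\ p = eta Y `\ q, psub false p s & psub true q s]].
Proof.
have [x [y [ep x0 j1]]] := flip_down.
have [x' [y' [ep' y'0 j2]]] := flip_up.
have [ip _ y0 j _ _] := ep; rewrite jt_catl // in j.
have [ip' x'0 _ j' _ _] := ep'; rewrite jt_catr // in j'.
exists x, y, x', y' => p q.
have ps : psub false p s by exists x, y; rewrite /p -catA.
have qs : psub true q s by exists x', y'.
have Xp : eta X p.
  apply/etaE; split; last by exists (x ++ s), y.
  by rewrite /p -catA; apply: vertical_jt => //; rewrite ?cat_nil_eq ?(negbTE s0) // jt_catr.
have Yq : eta Y q.
  apply/etaE; split; last by exists x', (s ++ y').
  rewrite /q catA; apply: vertical_jt => //; last by rewrite jt_catl.
  by rewrite cat_nil_eq (negbTE s0) andbF.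
have nYp : ~ eta Y p by move=> /(sep_eta p lY)[_ _ _ _ h]; apply: h ps Ys.
have nXq : ~ eta X q by move=> /(sep_eta q lX)[_ _ _ h _]; apply: nXs; apply: h qs.
split=> //; split=> //; apply/seteqP; split=> r [er nr]; split; try by move=> E; rewrite E in er.
- have /(sep_eta r lX) sr := er; have [ir nh nv SWr NEr] := sr.
  apply/(sep_eta r lY); split=> // t rt; first exact/XY/SWr.
  rewrite (cover_cc1 cXY ls) => /(cc_piece false) [].
    by move=> z [/(latS lX)|->].
  move=> v + tv; have rv := psub_sub rt tv; case=> [/(NEr _ rv)//|vs].
  rewrite vs in rv; case: rv => a [b [E a0 b0 _ [h1 h2]]].
  rewrite E in sr; have epr := sep_NE_epath sr a0 b0 h1 h2.
  case: nr; have [||Ea Eb] := epath_det epr ep.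
  + by rewrite !last_cat; case: (s) s0.
  + have sab := path_sorted_step (epath_path epr).
    have sxy := path_sorted_step (epath_path ep).
    have [as0 xs0] := (epath_l epr, epath_l ep).
    rewrite ((jt_step true as0 b0 sab).1) ?jt_catl //.
    rewrite ((jt_step true xs0 y0 sxy).1) ?jt_catl //.
    by rewrite !last_cat; case: (s) s0.
  + by rewrite E /p catA Ea Eb.
- have /(sep_eta r lY) sr := er; have [ir nh nv SWr NEr] := sr.
  apply/(sep_eta r lX); split=> // t rt; last by move=> /XY; apply: NEr.
  apply: contrapT => nXt.
  have rs := psub_sub rt (label_sub cXY ls (SWr _ rt) nXt).
  case: rs => a [b [E a0 b0 _ [h1 h2]]].
  rewrite E in sr; have epr := sep_SW_epath sr a0 b0 h1 h2.
  case: nr; have [||Ea Eb] := epath_det epr ep'.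
  + have sab := path_sorted_step (epath_path epr).
    have sxy := path_sorted_step (epath_path ep').
    have [as0 xs0] := (epath_r epr, epath_r ep').
    rewrite ((jt_step' true a0 as0 sab).1) ?jt_catr //.
    rewrite ((jt_step' true x'0 xs0 sxy).1) ?jt_catr //.
    by case: (s) s0.
  + by case: (s) s0.
  + by rewrite E /q Ea Eb.
Qed.

Lemma cover_flip : flip lam (eta X) (eta Y).
Proof.
have [x [y [x' [y' [ep ep' [Xp nYp] [Yq nXq] [E ps qs]]]]]] := cover_flip_paths.
split; [exact: eta_facet|exact: eta_facet|].
exists ((x ++ s) ++ y), (x' ++ s ++ y'), s; split=> //.
  by move=> E'; apply: nYp; rewrite E'.
by split=> //; apply/(WS_NE_psub (eta_path Xp) (eta_path Yq) s0).
Qed.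

End CoverFlip.

End Flips.

(** * The Grid-Tamari order and its congruences *)

Section GridTamari.

Variable lam : {fset vertex}.
Implicit Types (X Y Z S T D F G M x : set word).

Local Notation Seg := (Seg lam).
Local Notation concats := (concats lam).
Local Notation lat := (lat lam).
Local Notation eta := (eta lam).
Local Notation lat_of := (lat_of lam).
Local Notation facet := (facet lam).
Local Notation gt_le := (gt_le lam).

Lemma facet_lat F : facet F -> lat (lat_of F).
Proof. by case=> fF _; apply: lat_of_lat. Qed.

(* Otherwise the common paths of [F] and [G] all lie in [eta Y] and [eta Y'] for a
   lower cover [Y] and an upper cover [Y'] of [lat_of F], so that both covers
   exchange the same path [p]. *)
Lemma flip_mono F G : flip lam F G -> lat_of F `<=` lat_of G.
Proof.
case=> FF FG [p [q [s [Fp Gq npq E [Ss ws]]]]].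
have [fF fG] := (FF.1, FG.1).
have [lX lX'] := (facet_lat FF, facet_lat FG).
have [ip iq] := (face_path fF Fp, face_path fG Gq).
have /(WS_NE_psub ip iq (Seg_ne Ss))[ps qs] := ws.
set X := lat_of F in lX *; set X' := lat_of G in lX' *.
have nXs : ~ X s by apply: NEs_lat_of => //; exists p.
have X's : X' s by apply: cc1; exists q.
apply: contrapT => nXX'.
have Rp r : F r -> r <> p -> G r by move=> Fr nr; have [] : (G `\ q) r by rewrite -E.
have [lI lJ] := (lat_setI lX lX', lat_join lX lX').
have [] := exists_lower lI lX (@subIsetl _ _ _).
  by move=> EI; apply: nXX'; rewrite -EI; apply: subIsetr.
move=> Y cY IY.
have [|] := exists_upper lX lJ (fun t Xt => cc1 _ (or_introl Xt)).
  by move=> EJ; apply: nXs; rewrite EJ; apply: cc1; right.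
move=> Y' cY' Y'J.
have [lY _ YX nYX _] := cY; have [_ lY' XY' nXY' _] := cY'.
have R_Y r : F r -> r <> p -> eta Y r.
  move=> Fr nr; have Gr := Rp r Fr nr.
  have := face_sub_eta fF Fr => /(sep_eta r lX)[ir nh nv SWr NEr].
  apply/(sep_eta r lY); split=> // t rt; last by move=> /YX; apply: NEr.
  by apply: IY; split; [exact: SWr|apply: cc1; exists r].
have R_Y' r : F r -> r <> p -> eta Y' r.
  move=> Fr nr; have Gr := Rp r Fr nr.
  have := face_sub_eta fF Fr => /(sep_eta r lX)[ir nh nv SWr NEr].
  apply/(sep_eta r lY'); split=> // t rt; first exact/XY'/SWr.
  move=> /Y'J/(cc_piece false)[].
    by move=> z [/(latS lX)|/(latS lX')].
  move=> v XXv tv; have rv := psub_sub rt tv.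
  case: XXv; first exact: NEr.
  by apply: NEs_lat_of => //; exists r.
have [s1 ls1] := min_label lY lX YX nYX.
have [s2 ls2] := min_label lX lY' XY' nXY'.
have EF : eta X = F by rewrite -facet_eta.
have [_ [_ [x1 [y1 [_ ep1 _ [Fq1 nYq1] _]]]]] := cover_flip_paths cY ls1.
have [x2 [y2 [_ [_ [ep2 _ [Fp2 nYp2] _ _]]]]] := cover_flip_paths cY' ls2.
rewrite EF in Fq1 Fp2.
have E1 : x1 ++ s1 ++ y1 = p by apply: contrapT => /(R_Y _ Fq1).
have E2 : (x2 ++ s2) ++ y2 = p by apply: contrapT => /(R_Y' _ Fp2).
have [Ex Ey] := epath_unique ep1 ep2 (etrans E1 (esym E2)).
have [s10 s20] : s1 != [::] /\ s2 != [::].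
  by split; [case: ls1 => /(latS lX)/Seg_ne|case: ls2 => /(latS lY')/Seg_ne].
have j := epath_jt ep1; rewrite Ex jt_catl // jt_catr // in j.
have [Ys1 Ys2] : X s1 /\ Y' s2 by case: ls1 ls2 => ? _ _ [].
have nXs2 : ~ X s2 by case: ls2.
have S21 : Seg (s2 ++ s1).
  apply: Seg_cat; [exact: (latS lY' Ys2)|exact: (latS lX Ys1)|].
  have := path_sorted_step (epath_path ep1).
  rewrite Ex -catA => /sorted_catr; rewrite catA => /sorted_catl.
  by rewrite sorted_cat // => /and3P[].
(* [X] contains [s1] but not [s2 ++ s1] since [s1] is the label of a lower
   cover; then the label [s2] of an upper cover must be left to the East *)
have nX21 : ~ X (s2 ++ s1) by move/(label_S cY ls1 s20 j).
have Y'21 : Y' (s2 ++ s1) by apply: (latC lY') => //; apply: XY'.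
exact: jt_contra s20 s10 j (label_prefix cY' ls2 S21 s10 Y'21 nX21).
Qed.

Lemma le_eta X Y : lat X -> lat Y -> X `<=` Y -> gt_le (eta X) (eta Y).
Proof.
move=> + lY; have [n] := ubnP (mu lam Y - mu lam X); elim: n X => // n IH X ltn lX XY.
have [->|/eqP nXY] := eqVneq X Y; first exact: rt_refl.
have [Z cZ ZY] := exists_upper lX lY XY nXY; have [_ lZ XZ nXZ _] := cZ.
have [s ls] := min_label lX lZ XZ nXZ.
apply: (rt_trans _ _ _ (eta Z)); first by apply: rt_step; apply: cover_flip ls.
apply: IH => //; have := mu_lt XZ (latS lZ) nXZ.
have [->|/eqP nZY] := eqVneq Z Y; first by move: ltn; clear; lia.
by have := mu_lt ZY (latS lY) nZY; move: ltn; clear; lia.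
Qed.

Lemma gt_leP F G : facet F -> facet G -> gt_le F G <-> lat_of F `<=` lat_of G.
Proof.
move=> fF fG; split=> FG.
  elim: FG => {F G fF fG} [F G|F|F G H _ h1 _ h2]; first exact: flip_mono.
    by [].
  exact: (subset_trans h1 h2).
by rewrite (facet_eta fF) (facet_eta fG); apply: le_eta => //; apply: facet_lat.
Qed.

Lemma lat_of_inj F G : facet F -> facet G -> lat_of F = lat_of G -> F = G.
Proof. by move=> fF fG E; rewrite (facet_eta fF) E -facet_eta. Qed.

Lemma coversP F G : covers facet gt_le F G <->
  [/\ facet F, facet G & covers lat subset (lat_of F) (lat_of G)].
Proof.
split=> [[fF fG FG nFG h]|[fF fG [lF lG FG nFG h]]].
- split=> //; split; [exact: facet_lat|exact: facet_lat|exact/gt_leP| |].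
    by move=> /(lat_of_inj fF fG).
  move=> Z lZ FZ ZG; have fZ := eta_facet lZ.
  have [||E|E] := h (eta Z) fZ; try by apply/gt_leP; rewrite ?lat_of_eta.
  - by left; rewrite -E lat_of_eta.
  - by right; rewrite -E lat_of_eta.
- split=> //; first exact/gt_leP.
    by move=> E; apply: nFG; rewrite E.
  move=> Z fZ /(gt_leP fF fZ) FZ /(gt_leP fZ fG) ZG.
  by have [E|E] := h _ (facet_lat fZ) FZ ZG; [left|right]; apply: lat_of_inj.
Qed.

Lemma glb2P F G M : facet F -> facet G ->
  is_glb facet gt_le [set F; G] M <-> facet M /\ lat_of M = lat_of F `&` lat_of G.
Proof.
move=> fF fG; split=> [[fm mle mmax]|[fm E]].
- split=> //; apply/seteqP; split.
    by move=> s ms; split; [have /gt_leP := mle F (or_introl erefl)|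
      have /gt_leP := mle G (or_intror erefl)]; apply.
  have lFG := lat_setI (facet_lat fF) (facet_lat fG).
  have fI := eta_facet lFG.
  rewrite -[X in X `<=` _](lat_of_eta lFG); apply/gt_leP => //; apply: mmax => //.
  by move=> H [->|->]; apply/gt_leP => //; rewrite lat_of_eta //; move=> s [].
- split=> // [H [->|->]|H fH hH]; apply/gt_leP => //; rewrite E; try by move=> s [].
  by move=> s Hs; split; [have /gt_leP := hH F (or_introl erefl)|
    have /gt_leP := hH G (or_intror erefl)]; apply.
Qed.

Lemma lub2P F G M : facet F -> facet G ->
  is_lub facet gt_le [set F; G] M <-> facet M /\ lat_of M = concats (lat_of F `|` lat_of G).
Proof.
move=> fF fG; have lFG := lat_join (facet_lat fF) (facet_lat fG).
split=> [[fm mge mmin]|[fm E]].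
- split=> //; apply/seteqP; split; last first.
    apply: cc_min; first by case: (facet_lat fm).
    by move=> s []; [have /gt_leP := mge F (or_introl erefl)|
      have /gt_leP := mge G (or_intror erefl)]; apply.
  have fI := eta_facet lFG.
  rewrite -[X in _ `<=` X](lat_of_eta lFG); apply/gt_leP => //; apply: mmin => //.
  by move=> H [->|->]; apply/gt_leP => //; rewrite lat_of_eta // => s hs; apply: cc1;
    [left|right].
- split=> // [H [->|->]|H fH hH]; apply/gt_leP => //; rewrite E.
  + by move=> s hs; apply: cc1; left.
  + by move=> s hs; apply: cc1; right.
  + apply: cc_min; first by case: (facet_lat fH).
    by move=> s []; [have /gt_leP := hH F (or_introl erefl)|
      have /gt_leP := hH G (or_intror erefl)]; apply.
Qed.

(** * Congruences, labels and the sets [psi] *)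

Definition con_trace (K : set word) : set (set word * set word) :=
  [set FG | [/\ facet FG.1, facet FG.2 &
    forall s, K s -> (lat_of FG.1 s <-> lat_of FG.2 s)]].

(** A concatenation in [K] has all its pieces in [K], so the part of a join inside [K] depends only
    on the parts of the joinands inside [K]. *)
Lemma con_trace_congruence K : (forall s t, K s -> infix t s -> K t) ->
  congruence facet gt_le (con_trace K).
Proof.
move=> Kinf; have join X X' Y Y' s : (forall s, K s -> X s -> X' s) ->
    (forall s, K s -> Y s -> Y' s) -> concats (X `|` Y) s -> K s -> concats (X' `|` Y') s.
  move=> XX' YY'; elim=> {s} [s [Xs|Ys] Ks|a b h cb IH Sab Kab].
  - by apply: cc1; left; apply: XX'.
  - by apply: cc1; right; apply: YY'.
  - have Ka : K a by apply: Kinf Kab _; apply: prefix_infix.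
    have Kb : K b by apply: Kinf Kab _; apply: suffix_infix.
    by apply: cc_cons => //; [case: h => h; [left; apply: XX'|right; apply: YY']|apply: IH].
split.
- by move=> [F G] [].
- split.
  + by move=> F fF; split.
  + by move=> F G [fF fG h]; split=> // s /h /= ->.
  + by move=> F G H [/= fF fG h] [/= _ fH h']; split=> //= s Ks; rewrite h // h'.
- move=> F F' G G' m m' [/= fF fF' hF] [/= fG fG' hG].
  move=> /(glb2P _ fF fG)[fm E] /(glb2P _ fF' fG')[fm' E']; split=> //= s Ks.
  by rewrite E E' /setI /= hF // hG.
- move=> F F' G G' m m' [/= fF fF' hF] [/= fG fG' hG].
  move=> /(lub2P _ fF fG)[fm E] /(lub2P _ fF' fG')[fm' E']; split=> //= s Ks.
  rewrite E E'; split=> h.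
    by apply: join h Ks => t Kt; [move/hF|move/hG]; apply.
  by apply: join h Ks => t Kt; [have [_ h] := hF t Kt|have [_ h] := hG t Kt]; exact: h.
Qed.

Definition below s : set word := [set t | sub true s t /\ t <> s].

Lemma below_unique s X : Seg s -> covers lat subset X (sub true s) -> X = below s.
Proof.
move=> Ss cX; have [lX lA XA nXA _] := cX.
have Xb : X `<=` below s.
  move=> t Xt; split; first exact: XA.
  move=> ts; apply: nXA; apply/seteqP; split=> // u su.
  by rewrite ts in Xt; apply: (latA lX Xt).
by case: (cover_or_eq cX (lat_sub_proper Ss) Xb) => [t [] //|//|E];
  have [] : below s s by rewrite /below E; apply: sub_refl (Seg_ne Ss).
Qed.

Lemma below_covers s : Seg s -> covers lat subset (below s) (sub true s).
Proof.
move=> Ss; have ss := sub_refl true (Seg_ne Ss); split.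
- exact: lat_sub_proper.
- exact: lat_sub.
- by move=> t [].
- by move=> E; have [] : below s s by rewrite E.
- move=> Z lZ bZ ZA; have [Zs|nZs] := pselect (Z s).
    by right; apply/seteqP; split=> // t; apply: (latA lZ).
  by left; apply/seteqP; split=> // t Zt; split; [apply: ZA|move=> ts; rewrite ts in Zt].
Qed.

Lemma join_irrE s : Seg s -> join_irr lam s = eta (sub true s).
Proof. by move=> Ss; rewrite /join_irr (SWsubE Ss). Qed.

Lemma lower_starE s : Seg s -> lower_star lam (join_irr lam s) = eta (below s).
Proof.
move=> Ss; have [lA lb] := (lat_sub Ss, lat_sub_proper Ss).
rewrite join_irrE //; apply: get_subset1.
  by apply/coversP; split; try apply: eta_facet; rewrite ?lat_of_eta //; apply: below_covers.
move=> F G /coversP[fF _]; rewrite lat_of_eta // => /(below_unique Ss) EF.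
move=> /coversP[fG _]; rewrite lat_of_eta // => /(below_unique Ss) EG.
by apply: lat_of_inj => //; rewrite EF EG.
Qed.

(* The covers [F, G] and [eta (below s), eta (sub true s)] are perspective. *)
Lemma con_label F G s : covers facet gt_le F G -> label (lat_of F) (lat_of G) s ->
  con_GT lam F G = fhat lam s.
Proof.
move=> /coversP[fF fG cFG] ls; have [lF lG FG _ _] := cFG; have [Gs nFs As] := ls.
have Ss := latS lG Gs; have ss := sub_refl true (Seg_ne Ss).
have [lA lb] := (lat_sub Ss, lat_sub_proper Ss).
have [fA fb] := (eta_facet lA, eta_facet lb).
have AG : sub true s `<=` lat_of G by move=> t; apply: (latA lG).
have bF : below s `<=` lat_of F by move=> t [st ts]; apply: As.
have bA : below s `<=` sub true s by move=> t [].
rewrite /fhat lower_starE // join_irrE // /con_GT /con; congr (bigcap _ _).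
apply/seteqP; split=> R [cR RFG]; split=> //; have [_ [Rr _ _] Rm Rj] := cR.
(* Meeting with [sub true s] carries [F], [G] to [below s], [sub true s]; joining with [F] carries
   them back. *)
- apply: Rm RFG (Rr _ fA) _ _; apply/glb2P => //; split=> //; rewrite !lat_of_eta //.
    apply/seteqP; split=> [t bt|t [Ft At]]; first by split; [apply: bF|apply: bA].
    by split=> // ts; apply: nFs; rewrite -ts.
  by apply/seteqP; split=> [t At|t []//]; split=> //; apply: AG.
- apply: Rj (Rr _ fF) RFG _ _; apply/lub2P => //; split=> //; rewrite !lat_of_eta //.
    apply/seteqP; split=> [t Ft|]; first by apply: cc1; left.
    by apply: cc_min; [case: lF|move=> t [//|/bF]].
  exact: (cover_cc cFG ls).
Qed.

Lemma fhat_inj s t : Seg s -> Seg t -> fhat lam s = fhat lam t -> s = t.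
Proof.
have gen s' t' : Seg s' -> Seg t' -> fhat lam s' = fhat lam t' -> infix s' t'.
  move=> Ss St E; apply/negPn/negP => nst.
  (* Forgetting the segments that contain [s'] contracts the cover below the join-irreducible of
     [s']. If the congruences agree, it contracts that of [t'] too, so [t'] is among the forgotten
     ones. *)
  pose K := [set r : word | ~~ infix s' r].
  have Kinf r u : K r -> infix u r -> K u.
    by rewrite /K /= => nr ur; apply: contra nr => /infix_trans; apply.
  have [[lA lb] [lA' lb']] := ((lat_sub Ss, lat_sub_proper Ss), (lat_sub St, lat_sub_proper St)).
  pose R := con_trace K.
  have Rs : R (eta (below s'), eta (sub true s')).
    split; [exact: eta_facet|exact: eta_facet|move=> r Kr].
    rewrite !lat_of_eta //; split=> [[] //|sr]; split=> // rs.
    by move: Kr; rewrite /K /= rs infix_refl.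
  have : fhat lam s' `<=` R.
    move=> FG; rewrite /fhat lower_starE // join_irrE // => h.
    by apply: h; split=> //; apply: con_trace_congruence.
  rewrite E => /(_ (eta (below t'), eta (sub true t')))[].
    by rewrite /fhat lower_starE // join_irrE // => Q [].
  move=> _ _ /(_ t' nst); rewrite !lat_of_eta // => -[_ h].
  by have [] := h (sub_refl true (Seg_ne St)).
move=> Ss St E; have st := gen s t Ss St E; have ts := gen t s St Ss (esym E).
case/infixP: st => a [b Et].
move: (size_infix ts); rewrite Et !size_cat => h.
have a0 : a = [::] by apply: size0nil; move: h; clear; lia.
have b0 : b = [::] by apply: size0nil; move: h; clear; lia.
by rewrite a0 b0 cats0.
Qed.

Lemma lat_set0 : lat set0.
Proof. by split=> // s t []. Qed.

Lemma exists_cover_at X Z s : lat X -> lat Z -> X `<=` Z -> ~ X s -> Z s ->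
  exists W Y, [/\ covers lat subset W Y, X `<=` W, Y `<=` Z, ~ W s & Y s].
Proof.
move=> + lZ; have [n] := ubnP (mu lam Z - mu lam X); elim: n X => // n IH X ltn lX XZ nXs Zs.
have nXZ : X <> Z by move=> E; apply: nXs; rewrite E.
have [Y cY YZ] := exists_upper lX lZ XZ nXZ; have [_ lY XY nXY _] := cY.
have [Ys|nYs] := pselect (Y s); first by exists X, Y; split=> //; apply: subset_refl.
have [|W [V [cW YW VZ nWs Vs]]] := IH Y _ lY YZ nYs Zs; last first.
- by exists W, V; split=> //; apply: subset_trans YW.
have nYZ : Y <> Z by move=> E; apply: nYs; rewrite E.
have := mu_lt XY (latS lY) nXY; have := mu_lt YZ (latS lZ) nYZ.
by move: ltn; clear; lia.
Qed.

(** Given [s] on the right, climb from the join of [cover_meet] and [below s] to the join of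
    [cover_meet] and [sub true s]. The lower join misses [s], because otherwise an NE-subsegment of
    [s] would lie in [cover_meet] or in [below s]. The cover at which [s] appears has label [s]. *)
Lemma psi_GTE x : facet x -> psi_GT lam x = fhat lam @` wide_of lam (lat_of x).
Proof.
move=> fx; set X := lat_of x; have lX : lat X := facet_lat fx.
have lM := cover_meet_lat lX; have fM := eta_facet lM.
have Mlow y : covers facet gt_le y x -> gt_le (eta (cover_meet lam X)) y.
  move=> cy; have [fy _ cyX] := (coversP y x).1 cy.
  by apply/gt_leP => //; rewrite lat_of_eta // => t [_]; apply.
apply/seteqP; split=> R.
- case=> m [w [z [[fm _ mmax] mw cwz zx ->]]].
  have [fw fz cWZ] := (coversP w z).1 cwz; have [lW lZ WZ nWZ _] := cWZ.
  have [s ls] := min_label lW lZ WZ nWZ; have [Zs _ _] := ls.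
  exists s; last exact: (esym (con_label cwz ls)).
  split; first by apply: (gt_leP fz fx).1 zx _ Zs.
  move=> u su Mu; apply: (label_NE_bot cWZ ls su).
  apply: (gt_leP fm fw).1 mw _ _.
  have /(gt_leP fM fm) := mmax _ fM Mlow; apply.
  by rewrite lat_of_eta.
- case=> s [Xs hs] <-; have Ss := latS lX Xs.
  have [lA lb] := (lat_sub Ss, lat_sub_proper Ss).
  have [l0 l1] := (lat_join lM lb, lat_join lM lA).
  have AX : concats (cover_meet lam X `|` sub true s) `<=` X.
    by apply: cc_min; [case: lX|move=> t [[]//|]; apply: (latA lX Xs)].
  have [|||W [Z [cWZ bW ZA nWs Zs]]] := @exists_cover_at _ _ s l0 l1.
  + by apply: cc_mono => t [Mt|[At _]]; [left|right].
  + move=> /(cc_piece false)[].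
      by move=> t [/(latS lM)|/(latS lb)].
    move=> v [Mv|[Av vs]] sv; first exact: hs sv Mv.
    by apply: vs; apply: (sub_both (Seg_uniq Ss) Av sv).
  + by apply: cc1; right; apply: sub_refl (Seg_ne Ss).
  have ls : label W Z s.
    by split=> // t st ts; apply: bW; apply: cc1; right.
  have [lW lZ _ _ _] := cWZ; have [fW fZ] := (eta_facet lW, eta_facet lZ).
  have cw : covers facet gt_le (eta W) (eta Z) by apply/coversP; rewrite !lat_of_eta.
  exists (eta (cover_meet lam X)), (eta W), (eta Z); split=> //.
  + split=> // l fl hl; apply/gt_leP => //; rewrite lat_of_eta // => t lt.
    have lt_cover Y : covers lat subset Y X -> Y t.
      move=> cY; have [lY _ _ _ _] := cY; have fY := eta_facet lY.
      rewrite -(lat_of_eta lY); apply: (gt_leP fl fY).1 lt; apply: hl.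
      by apply/coversP; rewrite lat_of_eta.
    (* [X] is nonempty, hence covers something *)
    have [|Y cY _] := exists_lower lat_set0 lX (@sub0set _ _).
      by move=> E; move: Xs; rewrite -E.
    have [_ _ YX _ _] := cY; split; first exact: (YX _ (lt_cover _ cY)).
    by move=> V; apply: lt_cover.
  + by apply/gt_leP => //; rewrite !lat_of_eta // => t Mt; apply: bW; apply: cc1; left.
  + by apply/gt_leP => //; rewrite lat_of_eta //; apply: subset_trans AX.
  + by apply: esym; apply: con_label cw _; rewrite !lat_of_eta.
Qed.

End GridTamari.

Theorem theorem4p16 (lam : {fset vertex}) :
  (forall T : set (seq vertex), T `<=` Seg lam ->
     (wide lam T <->
      exists x, facet lam x /\ fhat lam @` T = psi_GT lam x)) /\
  inclusion_isomorphic (wide lam) (shard_order lam).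
Proof.
have wSeg X : lat lam X -> wide_of lam X `<=` Seg lam by move=> lX s [/(latS lX)].
have fhat_sub T T' : T `<=` Seg lam -> T' `<=` Seg lam ->
    fhat lam @` T `<=` fhat lam @` T' -> T `<=` T'.
  move=> TS TS' h s Ts; have [s' T's' E] := h _ (imageP (fhat lam) Ts).
  by rewrite -(fhat_inj (TS' _ T's') (TS _ Ts) E).
have main T : T `<=` Seg lam -> (wide lam T <->
    exists x, facet lam x /\ fhat lam @` T = psi_GT lam x).
  move=> TS; rewrite wideP wide_specP; split=> [[X lX ->]|[x [fx E]]].
    exists (eta lam X); split; first exact: eta_facet.
    by rewrite psi_GTE ?lat_of_eta //; apply: eta_facet.
  exists (lat_of lam x); first exact: facet_lat.
  have WS := wSeg _ (facet_lat fx).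
  by rewrite psi_GTE // in E; apply/seteqP; split; apply: fhat_sub => //; rewrite E.
split=> //; exists (fun T => fhat lam @` T); split.
  split.
  - move=> T wT; have TS : T `<=` Seg lam by case: wT.
    by have [x [fx E]] := (main T TS).1 wT; exists x.
  - move=> T T' /set_mem[TS _ _ _] /set_mem[T'S _ _ _] E.
    by apply/seteqP; split; apply: fhat_sub => //; rewrite E.
  - move=> _ [x fx <-]; exists (wide_of lam (lat_of lam x)); last by rewrite psi_GTE.
    by apply/(main _ (wSeg _ (facet_lat fx))); exists x; rewrite psi_GTE.
move=> T T' [TS _ _ _] [T'S _ _ _]; split; last exact: fhat_sub.
exact: image_subset.
Qed.
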